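(* Fix $T>0$ and let $(\mathbb X_t)_{t\in[0,T]}$ be an $\mathcal S$-valued $\mathcal U$-affine process with initial value $\mathbf x_0$ and operator $\mathcal L$ of $\mathcal U$-affine type with associated map $R:\mathcal U\to\mathcal S^*$. Fix $\mathbf u\in\mathcal U$ and suppose that the Riccati ODE (understood componentwise) $$\boldsymbol\psi(t)=\mathbf u+\int_0^tR(\boldsymbol\psi(s))\,ds$$ admits a $\mathcal U$-valued solution $(\boldsymbol\psi(t))_{t\in[0,T]}$ such that $\int_0^T|R(\boldsymbol\psi(s))|_{\mathbf x}\,ds<\infty$ for all $\mathbf x\in\mathcal S$. Moreover, assume that $$\mathbb E\Big[\sup_{s,t\le T}|\exp(\langle\boldsymbol\psi(s),\mathbb X_t\rangle)|\Big]<\infty\quad\text{and}\quad\mathbb E\Big[\sup_{s,t\le T}|\langle R(\boldsymbol\psi(s)),\mathbb X_t\rangle\exp(\langle\boldsymbol\psi(s),\mathbb X_t\rangle)|\Big]<\infty.$$ Then $\mathbb E[\exp(\langle\mathbf u,\mathbb X_T\rangle)]=\exp(\langle\boldsymbol\psi(T),\mathbf x_0\rangle)$.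
   Context: $T((\mathbb R^d))$ is the set of sequences $\mathbf a=(a_0,a_1,\dots)$ with $a_n\in(\mathbb R^d)^{\otimes n}$, $(\mathbb R^d)^{\otimes0}=\mathbb R$. For a multi-index $I=(i_1,\dots,i_n)\in\{1,\dots,d\}^n$, $|I|=n$ (the empty index has length $0$), $e_I=e_{i_1}\otimes\cdots\otimes e_{i_n}$, and $\mathbf a_I=\langle e_I,\mathbf a\rangle$ is the coefficient of $e_I$; $\pi_n(\mathbf a)=a_n$; $\langle\cdot,\cdot\rangle$ on $(\mathbb R^d)^{\otimes n}$ is the bilinear form for which $\{e_I:|I|=n\}$ is orthonormal (extended bilinearly to the complexification). State space and dual: $\mathcal S\subseteq T((\mathbb R^d))$ is a subset with the trace of the product sigma-algebra. $\Pi=\{\Pi_1,\Pi_2,\dots\}$ is a fixed partition of the set of all multi-indices such that each $\Pi_k$ contains only indices of the same length. For $\mathbf x\in\mathcal S$ and $\mathbf u\in T((\mathbb R^d))+\mathrm iT((\mathbb R^d))$, $|\mathbf u|_{\mathbf x}:=\sum_{k\ge1}|\sum_{I\in\Pi_k}\mathbf u_I\mathbf x_I|$; $\mathcal S^*:=\{\mathbf u\in T((\mathbb R^d))+\mathrm iT((\mathbb R^d)):|\mathbf u|_{\mathbf x}<\infty\ \forall\mathbf x\in\mathcal S\}$; for $\mathbf u\in\mathcal S^*$, $\mathbf x\in\mathcal S$: $\langle\mathbf u,\mathbf x\rangle:=\lim_{N\to\infty}\sum_{n=0}^N\langle\pi_n(\mathbf u),\pi_n(\mathbf x)\rangle$.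 Martingale problem: let $M(\mathcal S)$ be the set of maps $\mathcal S\to\mathbb C$, $D(\mathcal L)\subseteq M(\mathcal S)$ a linear subset and $\mathcal L:D(\mathcal L)\to M(\mathcal S)$ linear; fix a filtered probability space with right-continuous filtration. An $\mathcal S$-valued process $(\mathbb X_t)_{t\in[0,T]}$ solves the martingale problem for $\mathcal L$ if (1) $\mathbb X_0=\mathbf x$ for some initial value $\mathbf x\in\mathcal S$; (2) there is a version of $\mathbb X$ such that $(f(\mathbb X_t))_t$ and $(\mathcal Lf(\mathbb X_t))_t$ are adapted càdlàg processes for every $f\in D(\mathcal L)$; (3) $f(\mathbb X_t)-f(\mathbb X_0)-\int_0^t\mathcal Lf(\mathbb X_s)ds$ is a local martingale for every $f\in D(\mathcal L)$. Affine: let $\mathcal U\subseteq\mathcal S^*$ and $D(\mathcal L):=\mathrm{Span}\{\mathbf x\mapsto\exp(\langle\mathbf u,\mathbf x\rangle):\mathbf u\in\mathcal U\}$. A linear operator $\mathcal L:D(\mathcal L)\to M(\mathcal S)$ is of $\mathcal U$-affine type if there is a map $R:\mathcal U\to\mathcal S^*$ with $\mathcal L\exp(\langle\mathbf u,\cdot\rangle)(\mathbf x)=\exp(\langle\mathbf u,\mathbf x\rangle)\langle R(\mathbf u),\mathbf x\rangle$ for all $\mathbf u\in\mathcal U$, $\mathbf x\in\mathcal S$. Any solution of the martingale problem for such an $\mathcal L$ is called an $\mathcal S$-valued $\mathcal U$-affine process. *)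

(* Defs.v *)
From HB Require Import structures.
From mathcomp Require Import all_boot all_order all_algebra.
From mathcomp Require Import complex.
From mathcomp Require Import all_classical all_reals all_analysis.

Set Implicit Arguments.
Unset Strict Implicit.
Unset Printing Implicit Defensive.
Import Order.TTheory GRing.Theory Num.Theory.
Import numFieldNormedType.Exports.

Local Open Scope classical_set_scope.
Local Open Scope complex_scope.
Local Open Scope ring_scope.

(** ** Complex-valued analysis.
    Limits in [R[i]] are taken in [R[i]^o], whose topology is the one given by
    the modulus; integrals are taken on real and imaginary parts. *)

(* The library's norm [`|z|] of [z : R[i]] is again an element of [R[i]]. *)
Definition cmod (R : realType) (z : R[i]) : R := complex.Re `|z|.

Definition cexp (R : realType) (z : R[i]) : R[i] :=
  (expR (complex.Re z) * cos (complex.Im z))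
    +i* (expR (complex.Re z) * sin (complex.Im z)).

Definition cintegrable (R : realType) (disp : measure_display)
    (Z : measurableType disp) (mu : {measure set Z -> \bar R}) (D : set Z)
    (f : Z -> R[i]) : Prop :=
  mu.-integrable D (fun z => (complex.Re (f z))%:E) /\
  mu.-integrable D (fun z => (complex.Im (f z))%:E).

Definition cintegral (R : realType) (disp : measure_display)
    (Z : measurableType disp) (mu : {measure set Z -> \bar R}) (D : set Z)
    (f : Z -> R[i]) : R[i] :=
  (\int[mu]_(z in D) complex.Re (f z)) +i* (\int[mu]_(z in D) complex.Im (f z)).

(** ** The extended tensor algebra.
    An element [a] of T((R^d)) is given by its coefficients [a I] in the basis
    of the [e_I], where the multi-index [I] is a word over ['I_d] of length
    [size I]; [V = R] gives T((R^d)) and [V = R[i]] its complexification. *)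

Definition tensor_series (V : Type) (d : nat) : Type := seq 'I_d -> V.

(* The coefficients of the [a_n] generate the product of the Borel
   sigma-algebras of the (R^d)^{(x) n}. *)
Definition tensor_sigma_algebra (R : realType) (d : nat) :
    set (set (tensor_series R d)) :=
  <<s [set A | exists (I : seq 'I_d) (B : set R),
         measurable B /\ A = (fun a : tensor_series R d => a I) @^-1` B] >>.

Definition homogeneous_partition (d : nat) (Pi : nat -> set (seq 'I_d)) : Prop :=
  partition setT Pi setT /\
  forall k I J, Pi k I -> Pi k J -> size I = size J.

Definition block_norm (R : realType) (d : nat) (Pi : nat -> set (seq 'I_d))
    (x : tensor_series R d) (u : tensor_series R[i] d) : \bar R :=
  (\sum_(0 <= k <oo) (cmod (\sum_(I \in Pi k) u I * (x I)%:C)%R)%:E)%E.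

Definition tensor_dual (R : realType) (d : nat) (Pi : nat -> set (seq 'I_d))
    (S : set (tensor_series R d)) : set (tensor_series R[i] d) :=
  [set u | forall x, S x -> (block_norm Pi x u < +oo)%E].

Definition level_pairing (R : realType) (d : nat) (n : nat)
    (u : tensor_series R[i] d) (x : tensor_series R d) : R[i] :=
  \sum_(I : n.-tuple 'I_d) u I * (x I)%:C.

Definition pairing (R : realType) (d : nat)
    (u : tensor_series R[i] d) (x : tensor_series R d) : R[i] :=
  lim ((fun N : nat => \sum_(n < N.+1) level_pairing n u x : R[i]^o) @ \oo).

(** ** Filtrations, stopping times and local martingales.
    Filtrations are indexed by [0, +oo[ and processes by [0, T]; the values at
    other times are irrelevant. *)

Record filtration (R : realType) (disp : measure_display)
    (Omega : measurableType disp) (F : R -> set (set Omega)) : Prop := {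
  filtration_sigma_algebra : forall t, 0 <= t -> sigma_algebra setT (F t) ;
  filtration_measurable : forall t, 0 <= t -> F t `<=` measurable ;
  filtration_mono : forall s t, 0 <= s -> s <= t -> F s `<=` F t }.

Definition right_continuous_filtration (R : realType) (disp : measure_display)
    (Omega : measurableType disp) (F : R -> set (set Omega)) : Prop :=
  forall t, 0 <= t -> \bigcap_(s in [set s | t < s]) F s = F t.

Definition sub_measurable (R : realType) (Omega : Type) (G : set (set Omega))
    (f : Omega -> R[i]) : Prop :=
  forall B : set R, measurable B ->
    G ((fun w => complex.Re (f w)) @^-1` B) /\
    G ((fun w => complex.Im (f w)) @^-1` B).

Definition adapted (R : realType) (Omega : Type) (F : R -> set (set Omega))
    (T : R) (M : R -> Omega -> R[i]) : Prop :=
  forall t, 0 <= t <= T -> sub_measurable (F t) (M t).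

Definition cadlag (R : realType) (T : R) (f : R -> R[i]^o) : Prop :=
  (forall t, 0 <= t < T -> f @ t^'+ --> f t) /\
  (forall t, 0 < t <= T -> cvg (f @ t^'-)).

(* The last clause is E[M_t | F_s] = M_s, by the defining property of the
   conditional expectation. *)
Definition martingale (R : realType) (disp : measure_display)
    (Omega : measurableType disp) (P : probability Omega R)
    (F : R -> set (set Omega)) (T : R) (M : R -> Omega -> R[i]) : Prop :=
  [/\ adapted F T M,
      forall t, 0 <= t <= T -> cintegrable P setT (M t) &
      forall s t, 0 <= s -> s <= t -> t <= T ->
        forall A, F s A -> cintegral P A (M t) = cintegral P A (M s)].

Definition stopping_time (R : realType) (Omega : Type)
    (F : R -> set (set Omega)) (tau : Omega -> \bar R) : Prop :=
  (forall w, (0 <= tau w)%E) /\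
  (forall t, 0 <= t -> F t [set w | (tau w <= t%:E)%E]).

Definition stopped (R : realType) (Omega : Type) (M : R -> Omega -> R[i])
    (tau : Omega -> \bar R) (t : R) (w : Omega) : R[i] :=
  M (fine (Order.min t%:E (tau w))) w.

Definition local_martingale (R : realType) (disp : measure_display)
    (Omega : measurableType disp) (P : probability Omega R)
    (F : R -> set (set Omega)) (T : R) (M : R -> Omega -> R[i]) : Prop :=
  adapted F T M /\
  exists tau : nat -> Omega -> \bar R,
    [/\ forall n, stopping_time F (tau n),
        {ae P, forall w, nondecreasing_seq (fun n => tau n w)},
        {ae P, forall w, (fun n => tau n w) @ \oo --> +oo%E} &
        forall n, martingale P F T (stopped M (tau n))].

(** ** The martingale problem.
    Maps from the state space [S] to the complex numbers are functions on the
    subtype of [S]; an operator with domain [D] is a total function of which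
    only the values on [D] matter. *)

Definition linear_operator (R : realType) (E : Type)
    (D : set (E -> R[i])) (L : (E -> R[i]) -> (E -> R[i])) : Prop :=
  D (fun _ => 0) /\
  forall (c : R[i]) f g, D f -> D g ->
    D (fun x => c * f x + g x) /\
    L (fun x => c * f x + g x) = (fun x => c * L f x + L g x).

Definition tensor_process (R : realType) (disp : measure_display)
    (Omega : measurableType disp) (d : nat) (S : set (tensor_series R d))
    (T : R) (X : R -> Omega -> S) : Prop :=
  forall t, 0 <= t <= T -> forall A, tensor_sigma_algebra A ->
    measurable [set w | A (val (X t w))].

Definition version_of (R : realType) (disp : measure_display)
    (Omega : measurableType disp) (P : probability Omega R) (E : Type)
    (T : R) (X Y : R -> Omega -> E) : Prop :=
  forall t, 0 <= t <= T -> {ae P, forall w, Y t w = X t w}.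

(* The time integral in the third condition is only meaningful along the
   cadlag paths of the version [Y] of the second condition, so it is stated
   for [Y]. *)
Definition solves_martingale_problem (R : realType) (disp : measure_display)
    (Omega : measurableType disp) (P : probability Omega R)
    (F : R -> set (set Omega)) (d : nat) (S : set (tensor_series R d))
    (D : set (S -> R[i])) (L : (S -> R[i]) -> (S -> R[i]))
    (T : R) (x0 : S) (X : R -> Omega -> S) : Prop :=
  [/\ tensor_process T X,
      {ae P, forall w, X 0 w = x0} &
      exists Y : R -> Omega -> S,
        [/\ tensor_process T Y,
            version_of P T X Y,
            forall f, D f ->
              [/\ adapted F T (fun t w => f (Y t w)),
                  adapted F T (fun t w => L f (Y t w)),
                  forall w, cadlag T (fun t => f (Y t w)) &
                  forall w, cadlag T (fun t => L f (Y t w))] &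
            forall f, D f ->
              local_martingale P F T (fun t w =>
                f (Y t w) - f (Y 0 w)
                - cintegral lebesgue_measure `[0, t] (fun s => L f (Y s w)))]].

(** ** Affine operators and processes. *)

Definition exp_pairing (R : realType) (d : nat) (S : set (tensor_series R d))
    (u : tensor_series R[i] d) : S -> R[i] :=
  fun x => cexp (pairing u (val x)).

Definition exp_span (R : realType) (d : nat) (S : set (tensor_series R d))
    (U : set (tensor_series R[i] d)) : set (S -> R[i]) :=
  [set f | exists (n : nat) (c : 'I_n -> R[i]) (u : 'I_n -> tensor_series R[i] d),
     (forall i, U (u i)) /\
     f = (fun x => \sum_(i < n) c i * exp_pairing (u i) x)].

(* [A] is the map R of the affine operator. *)
Definition affine_operator (R : realType) (d : nat)
    (Pi : nat -> set (seq 'I_d)) (S : set (tensor_series R d))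
    (U : set (tensor_series R[i] d)) (L : (S -> R[i]) -> (S -> R[i]))
    (A : tensor_series R[i] d -> tensor_series R[i] d) : Prop :=
  [/\ linear_operator (@exp_span R d S U) L,
      forall u, U u -> tensor_dual Pi S (A u) &
      forall u, U u -> forall x : S,
        L (@exp_pairing R d S u) x = exp_pairing u x * pairing (A u) (val x)].

(* Part of being a solution is that the components of [A (psi s)] are
   Lebesgue integrable, so that the integral equation is meaningful. *)
Definition riccati_solution (R : realType) (d : nat)
    (U : set (tensor_series R[i] d))
    (A : tensor_series R[i] d -> tensor_series R[i] d) (T : R)
    (u : tensor_series R[i] d) (psi : R -> tensor_series R[i] d) : Prop :=
  [/\ forall t, 0 <= t <= T -> U (psi t),
      forall I, cintegrable lebesgue_measure `[0, T] (fun s => A (psi s) I) &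
      forall I t, 0 <= t <= T ->
        psi t I = u I
          + cintegral lebesgue_measure `[0, t] (fun s => A (psi s) I)].

(* Main.v *)
Require Import Defs.
From HB Require Import structures.
From mathcomp Require Import all_boot all_order all_algebra.
From mathcomp Require Import complex.
From mathcomp Require Import all_classical all_reals all_analysis.
From mathcomp Require Import lra ring measurable_realfun.
Import Order.TTheory GRing.Theory Num.Theory.
Import numFieldNormedType.Exports.

Local Open Scope classical_set_scope.
Local Open Scope complex_scope.
Local Open Scope ring_scope.

(** Put f(s,t) = E[exp<psi(s),X_t>] and h(s,t) = E[exp<psi(s),X_t> <A(psi(s)),X_t>]
for s and t in [0,T].  The function f grows at the same rate h in both variables.

In s this holds along every path: since psi solves the Riccati equation, the map
s |-> <psi(s),x> is absolutely continuous with density <A(psi(s)),x>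
([primitive_pairing]), and the chain rule for absolutely continuous functions
applies to its exponential ([primitive_cexp]).  In t it is the martingale problem:
the operator multiplies exp<psi(s),.> by <A(psi(s)),.>, and the local martingale
attached to exp<psi(s),.> is dominated by an integrable variable, hence centred
([local_martingale_mean0]).  A function whose two partial derivatives agree depends
on s + t only, so f(0,T) = f(T,0), which is the claim because psi(0) = u and X_0 = x0.

As h is merely bounded and measurable, the partial derivatives exist only almost
everywhere on each horizontal and vertical line, and the antidiagonal s + t = T may
miss all these points.  The argument is therefore run one integration higher: by
Fubini, the form f (ds + dt) has zero integral around every rectangle, so it has a
potential of class C^1; the derivative of this potential along an antidiagonal
vanishes, whence f(0,.) and f(.,0) have the same integral over [0,T'] for every
T' <= T, and f(0,T) = f(T,0) follows by continuity ([antidiagonal_endpoints],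
[common_density_endpoints], [expectation_exchange]).

Two further points need care.  The pairing is a limit over tensor levels whereas the
hypotheses control the sums over the blocks of Pi; as every block lies inside one
level, the sum of the moduli of the levels is at most the block norm
([sum_cmod_level_le]), which yields both convergence and domination.  The suprema in
the moment conditions range over uncountably many times and need not be measurable,
so that their integrals are only lower integrals.  They are used solely as upper
bounds: the right-continuous version is dominated by its supremum over rational
times, which almost surely equals a countable supremum taken along X
([version_dominated]). *)

(** * A mean value inequality and absolutely continuous functions *)

Section real_analysis.
Context {R : realType}.
Implicit Types (q phi v : R -> R) (s t T : R).
Notation mu := (@lebesgue_measure R).

Lemma Rintegral_itv_cat q a b c : a <= b -> b <= c ->
  mu.-integrable `[a, c] (EFin \o q) ->
  \int[mu]_(x in `[a, c]) q x
    = \int[mu]_(x in `[a, b]) q x + \int[mu]_(x in `[b, c]) q x.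
Proof.
move=> ab bc iq.
have iq' : mu.-integrable `]b, c] (EFin \o q).
  apply: integrableS iq => //.
  by apply: subset_itvr; rewrite bnd_simp.
rewrite -(Rintegral_itv_obnd_cbnd iq').
rewrite -(@Rintegral_itvB _ q (BLeft a) (BRight c) b)// ?bnd_simp//.
by rewrite addrC subrK.
Qed.

Lemma integrable_sub_itv q a b c e : a <= c -> e <= b ->
  mu.-integrable `[a, b] (EFin \o q) -> mu.-integrable `[c, e] (EFin \o q).
Proof.
move=> ac eb; apply: integrableS => //.
by apply: subset_itvScc.
Qed.

(** The inequality propagates from 0: the supremum c of the points reached is itself
reached, by comparison with reached points close to c on its left, and a point
c < T can be passed, by comparison with points on its right.  No derivative is
involved, so the lemma applies to integrals of discontinuous functions. *)
Lemma local_increment_le phi v T : 0 <= T ->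
  {in `[0, T] &, {homo v : s t / s <= t}} ->
  (forall t, 0 <= t <= T -> exists2 delta, 0 < delta &
     forall s, 0 <= s <= T -> `|s - t| < delta ->
       `|phi s - phi t| <= `|v s - v t|) ->
  `|phi T - phi 0| <= v T - v 0.
Proof.
move=> T0 vnd loc.
pose A := [set x | 0 <= x <= T /\ `|phi x - phi 0| <= v x - v 0].
have A0 : A 0 by rewrite /A /= lexx T0 !subrr normr0.
have supA : has_sup A by split; [exists 0 | exists T => x [/andP[]]].
set c := sup A.
have c0T : 0 <= c <= T.
  apply/andP; split; first exact: (sup_upper_bound supA).
  by apply: ge_sup; [exists 0|move=> x [/andP[]]].
have [d d0 locc] := loc c c0T.
have step s t : 0 <= s -> s <= t -> t <= T ->
    `|phi s - phi 0| <= v s - v 0 -> `|phi t - phi s| <= `|v t - v s| ->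
    `|phi t - phi 0| <= v t - v 0.
  move=> s0 st tT h1; rewrite (@ger0_norm _ (v t - v s)); last first.
    rewrite subr_ge0 vnd// in_itv/= ?s0 ?(le_trans st)//.
    by rewrite (le_trans s0 st).
  have := ler_normD (phi t - phi s) (phi s - phi 0).
  by rewrite addrA subrK; lra.
have Ac : A c.
  split=> //.
  have [x Ax xc] := sup_adherent d0 supA.
  have xc' : x <= c by exact: (sup_upper_bound supA).
  case: Ax => /andP[x0 xT] hx; apply: (step x c) => //.
    by case/andP: c0T.
  rewrite distrC [leRHS]distrC; apply: locc; first by rewrite x0.
  rewrite ler0_norm; last by rewrite subr_le0.
  by rewrite -/c in xc; lra.
have [cT|] := ltP c T; last first.
  move=> Tc; have -> : T = c by apply/eqP; rewrite eq_le Tc; case/andP: c0T.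
  by case: Ac.
pose e := Num.min T (c + d / 2).
have eT : e <= T by rewrite /e ge_min lexx.
have ce : c < e by rewrite /e lt_min cT ltrDl divr_gt0.
case/andP: (c0T) => cge0 _.
have : A e.
  split; first by rewrite eT (le_trans cge0) ?ltW.
  apply: (step c e) => //; first exact: ltW.
    by case: Ac.
  apply: locc; first by rewrite eT (le_trans cge0) ?ltW.
  rewrite gtr0_norm ?subr_gt0//.
  have : e <= c + d / 2 by rewrite /e ge_min lexx orbT.
  by lra.
by move=> /(sup_upper_bound supA); rewrite -/c leNgt ce.
Qed.

End real_analysis.

Section primitives.
Context {R : realType}.
Implicit Types (p q f g : R -> R) (s t T : R).
Notation mu := (@lebesgue_measure R).

(** Absolute continuity of [p] on [0, T] in integrated form, with density [q]. *)
Definition primitive_of T q p :=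
  mu.-integrable `[0, T] (EFin \o q) /\
  forall t, 0 <= t <= T -> p t = p 0 + \int[mu]_(x in `[0, t]) q x.

Lemma eq_primitive_of T q p q' p' :
  {in `[0, T], q =1 q'} -> {in `[0, T], p =1 p'} ->
  primitive_of T q p -> primitive_of T q' p'.
Proof.
move=> qq pp [iq hp]; split.
  by apply: eq_integrable iq => // x; rewrite inE => xT /=; rewrite qq.
move=> t /andP[t0 tT]; rewrite -!pp ?in_itv/= ?t0 ?lexx ?(le_trans t0)//.
rewrite hp ?t0//; congr (_ + _); apply: eq_Rintegral => x.
by rewrite inE/= in_itv/= => /andP[x0 xt]; rewrite qq// in_itv/= x0 (le_trans xt).
Qed.

Lemma primitive_ofB T q p s t : primitive_of T q p ->
  0 <= s -> s <= t -> t <= T -> p t - p s = \int[mu]_(x in `[s, t]) q x.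
Proof.
move=> [iq hp] s0 st tT.
rewrite (hp t) ?tT ?(le_trans s0)// (hp s) ?s0 ?(le_trans st)//.
rewrite (@Rintegral_itv_cat _ q 0 s t)//; last exact: integrable_sub_itv iq.
by ring.
Qed.

Lemma primitive_of_continuous T q p : 0 <= T -> primitive_of T q p ->
  {within `[0, T], continuous p}.
Proof.
move=> T0 [iq hp].
have /subspace_continuousP cI := parameterized_integral_continuous T0 iq.
apply/subspace_continuousP => x /= xT.
rewrite [X in _ --> X](hp x)//.
have : p 0 + parameterized_integral mu 0 y q @[y --> within `[0, T] (nbhs x)]
    --> p 0 + parameterized_integral mu 0 x q.
  by apply: cvgD; [exact: cvg_cst|exact: cI].
apply: cvg_trans; apply: near_eq_cvg.
near=> y; rewrite [RHS]hp//.
by near: y; apply: withinT.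
Unshelve. all: by end_near. Qed.

(** This primitive is the total variation of [p]; it serves as the majorant in
[local_increment_le]. *)
Lemma primitive_of_norm T q p : primitive_of T q p ->
  primitive_of T (fun x => `|q x|) (fun t => \int[mu]_(x in `[0, t]) `|q x|).
Proof.
move=> [iq hp]; split; first exact: integrable_norm.
by move=> t _; rewrite set_itv1 Rintegral_set1 add0r.
Qed.

Lemma within_itv_near f T t e : 0 < e -> {within `[0, T], continuous f} ->
  0 <= t <= T -> exists2 d, 0 < d &
    forall s, 0 <= s <= T -> `|s - t| < d -> `|f s - f t| < e.
Proof.
move=> e0 /subspace_continuousP cf tT.
have /cvgrPdist_lt/(_ _ e0) := cf t tT.
rewrite near_withinE => -[d /= d0 hd]; exists d => // s sT std.
by rewrite distrC; apply: hd => //=; rewrite distrC.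
Qed.

(** Chain rule at points where the density may have no limit.  Over a short interval
[a, b] the mean value theorem and the intermediate value theorem give
g(p b) - g(p a) = g'(p xi) (p b - p a) for some xi in [a, b], and g' o p is
continuous, so this increment differs from the integral of (g' o p) q by at most
epsilon times the integral of |q|. *)
Lemma primitive_of_comp T q p g g' : 0 <= T -> primitive_of T q p ->
  (forall x : R, is_derive x 1 g (g' x)) -> continuous g' ->
  primitive_of T (fun s => g' (p s) * q s) (g \o p).
Proof.
move=> T0 qp dg cg'.
have cp := primitive_of_continuous _ _ _ T0 qp.
pose G := g' \o p.
have cG : {within `[0, T], continuous G}.
  have /subspace_continuousP cp' := cp.
  apply/subspace_continuousP => x xT.
  exact: (cvg_comp _ _ (cp' x xT) (cg' (p x))).
have mG : measurable_fun `[0, T] G by exact: subspace_continuous_measurable_fun.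
have bG : [bounded G x | x in `[0, T]%classic].
  have /compact_bounded [M [Mr MG]] : compact (G @` `[0, T]).
    by apply: continuous_compact => //; exact: segment_compact.
  exists M; split=> // N MN x xT; apply: (MG N MN).
  by exists x.
have iGq : mu.-integrable `[0, T] (EFin \o (fun s => G s * q s)).
  exact: (@integrableMr _ (measurableTypeR R) R mu _ _ G _ mG bG (proj1 qp)).
split=> // t /andP[t0 tT].
pose Phi s := g (p s) - \int[mu]_(x in `[0, s]) (G x * q x).
suff : Phi t = Phi 0.
  rewrite /Phi set_itv1 Rintegral_set1 /=; lra.
pose V s := \int[mu]_(x in `[0, s]) `|q x|.
have hV := primitive_of_norm _ _ _ qp.
have Vnd : {in `[0, t] &, {homo V : s t / s <= t}}.
  move=> x y; rewrite !in_itv/= => /andP[x0 xt] /andP[y0 yt] xy.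
  rewrite -subr_ge0 (primitive_ofB _ _ _ _ _ hV)// ?(le_trans yt)//.
  by apply: Rintegral_ge0.
suff H e : 0 < e -> `|Phi t - Phi 0| <= e * V t - e * V 0.
  have VT0 : V 0 = 0 by rewrite /V set_itv1 Rintegral_set1.
  have VTge : 0 <= V t by rewrite /V; apply: Rintegral_ge0.
  apply/eqP; rewrite -subr_eq0 -normr_le0; apply/ler_addgt0Pr => e e0.
  rewrite add0r.
  have d0 : 0 < e / (V t + 1) by rewrite divr_gt0// ltr_wpDl.
  apply: (le_trans (H _ d0)).
  rewrite VT0 mulr0 subr0 -mulrA ler_piMr// ?(ltW e0)//.
  by rewrite mulrC ler_pdivrMr ?ltr_wpDl// mul1r lerDl.
move=> e0; have e20 : 0 < e / 2 by rewrite divr_gt0.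
apply: (@local_increment_le _ Phi (fun s => e * V s)) => //.
  by move=> x y xt yt xy; rewrite ler_pM2l// Vnd.
move=> x /andP[x0 xt].
have xT : 0 <= x <= T by rewrite x0 (le_trans xt).
have [d d0 hd] := within_itv_near _ _ _ _ e20 cG xT.
exists d => // y /andP[y0 yt] yxd.
have key a b : 0 <= a -> a <= b -> b <= t -> `|a - x| < d -> `|b - x| < d ->
    `|Phi b - Phi a| <= e * (V b - V a).
  move=> a0 ab bt ad bd.
  have bT : b <= T by exact: le_trans bt tT.
  have Iab : `[a, b]%classic `<=` `[0, T]%classic.
    by apply: subset_itvScc.
  have near r : a <= r <= b -> `|G r - G x| < e / 2.
    move=> /andP[ar rb]; apply: hd; first by rewrite (le_trans a0 ar) (le_trans rb).
    by move: ad bd; rewrite !ltr_norml; lra.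
  have [xi xiab gpE] : exists2 xi, a <= xi <= b &
      g (p b) - g (p a) = G xi * (p b - p a).
    have cpab : {within `[a, b], continuous p} by exact: continuous_subspaceW cp.
    have cgab u w : {within `[u, w], continuous g}.
      apply: continuous_subspaceT => z.
      by apply: differentiable_continuous; apply/derivable1_diffP; case: (dg z).
    have [pab|pba] := leP (p a) (p b).
      have [c cab gc] := @MVT_segment _ g g' _ _ pab (fun x _ => dg x) (cgab _ _).
      have [|xi xiab pxi] := @IVT _ p a b c ab cpab.
        by move: cab; rewrite in_itv/= min_l// max_r.
      by exists xi => //; rewrite /G/= pxi.
    have [c cab gc] := @MVT_segment _ g g' _ _ (ltW pba) (fun x _ => dg x) (cgab _ _).
    have [|xi xiab pxi] := @IVT _ p a b c ab cpab.
      by move: cab; rewrite in_itv/= min_r ?max_l// ltW.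
    by exists xi => //; rewrite /G/= pxi -opprB gc -mulrN opprB.
  have iq : mu.-integrable `[a, b] (EFin \o q).
    by apply: integrable_sub_itv (proj1 qp).
  have iGqab : mu.-integrable `[a, b] (EFin \o (fun s => G s * q s)).
    by apply: integrable_sub_itv iGq.
  have -> : Phi b - Phi a = \int[mu]_(r in `[a, b]) ((G xi - G r) * q r).
    rewrite /Phi (Rintegral_itv_cat (fun x => G x * q x) _ _ _ a0 ab); last first.
      by apply: integrable_sub_itv iGq.
    rewrite opprD addrA (addrC (_ - _) (- \int[mu]_(x in `[a, b]) _)).
    have -> : \int[mu]_(r in `[a, b]) ((G xi - G r) * q r) =
        G xi * \int[mu]_(r in `[a, b]) q r - \int[mu]_(r in `[a, b]) (G r * q r).
      rewrite -RintegralZl// -RintegralB//; last first.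
        by apply: eq_integrable (integrableZl _ (G xi) iq).
      by apply: eq_Rintegral => r _; rewrite mulrBl.
    rewrite -(primitive_ofB _ _ _ _ _ qp)// -gpE.
    by ring.
  have iD : mu.-integrable `[a, b] (EFin \o (fun r => (G xi - G r) * q r)).
    apply: eq_integrable (integrableB _ (integrableZl _ (G xi) iq) iGqab) => //.
    by move=> z _ /=; rewrite mulrBl EFinB EFinM.
  apply: (le_trans (le_normr_Rintegral _ iD)) => //.
  rewrite (primitive_ofB _ _ _ _ _ hV)// -RintegralZl//; last first.
    exact: integrable_norm.
  apply: le_Rintegral => //.
  - exact: integrable_norm.
  - have iqn : mu.-integrable `[a, b] (EFin \o (fun x => `|q x|)).
      exact: integrable_norm.
    by apply: eq_integrable (integrableZl _ e iqn).
  move=> r /=; rewrite in_itv/= => rab; rewrite normrM ler_wpM2r//.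
  have := near _ rab; have := near _ xiab.
  by rewrite ltr_norml ltr_norml ler_norml; lra.
have [yx|xy] := leP y x.
  rewrite distrC [leRHS]distrC (le_trans (key y x y0 yx xt yxd _))//.
    by rewrite subrr normr0.
  by rewrite mulrBr ler_norm.
rewrite (le_trans (key x y x0 (ltW xy) yt _ yxd))//.
  by rewrite subrr normr0.
by rewrite mulrBr ler_norm.
Qed.

Lemma primitive_ofD T q1 p1 q2 p2 : primitive_of T q1 p1 ->
  primitive_of T q2 p2 ->
  primitive_of T (fun s => q1 s + q2 s) (fun s => p1 s + p2 s).
Proof.
move=> [i1 h1] [i2 h2]; split.
  by apply: eq_integrable (integrableD _ i1 i2).
move=> t /andP[t0 tT]; rewrite h1 ?t0// h2 ?t0// RintegralD//; first by ring.
- exact: integrable_sub_itv i1.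
- exact: integrable_sub_itv i2.
Qed.

Lemma primitive_ofZ T q p c : primitive_of T q p ->
  primitive_of T (fun s => c * q s) (fun s => c * p s).
Proof.
move=> [i h]; split.
  by apply: eq_integrable (integrableZl _ c i).
move=> t /andP[t0 tT]; rewrite h ?t0// RintegralZl//; first by ring.
exact: integrable_sub_itv i.
Qed.

(** By polarization, the product rule is the chain rule for the square. *)
Lemma primitive_ofM T q1 p1 q2 p2 : 0 <= T -> primitive_of T q1 p1 ->
  primitive_of T q2 p2 ->
  primitive_of T (fun s => q1 s * p2 s + p1 s * q2 s) (fun s => p1 s * p2 s).
Proof.
move=> T0 h1 h2.
have sq q p : primitive_of T q p ->
    primitive_of T (fun s => 2 * p s * q s) (fun s => p s ^+ 2).
  move=> h; apply: (primitive_of_comp T q p (fun x => x ^+ 2) (fun x => 2 * x)) => //.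
    move=> x; rewrite (_ : (fun y : R => y ^+ 2) = (@id R) ^+ 2); last first.
      by apply/funext => y; rewrite exprfctE.
    by apply: is_derive_eq; rewrite /GRing.scale/= expr1 mulr1.
  by move=> x; apply: cvgM; [exact: cvg_cst|exact: cvg_id].
have := primitive_ofZ _ _ _ (2^-1) (primitive_ofD _ _ _ _ _
  (sq _ _ (primitive_ofD _ _ _ _ _ h1 h2))
  (primitive_ofZ _ _ _ (-1) (primitive_ofD _ _ _ _ _ (sq _ _ h1) (sq _ _ h2)))).
by apply: eq_primitive_of => x _; field.
Qed.

End primitives.

(** * Functions with equal growth in two variables *)

Section antidiagonal.
Context {R : realType}.
Notation mu := (@lebesgue_measure R).

Lemma Rintegral_near_cst (q : R -> R) a b c M : a <= b ->
  mu.-integrable `[a, b] (EFin \o q) ->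
  (forall x, a <= x <= b -> `|q x - c| <= M) ->
  `|\int[mu]_(x in `[a, b]) q x - (b - a) * c| <= M * (b - a).
Proof.
move=> ab iq qc.
have muab : fine (mu `[a, b]%classic) = b - a.
  by rewrite lebesgue_measure_itv/= lte_fin; case: ltP => //= ba; lra.
have icst k : mu.-integrable `[a, b] (EFin \o (fun=> k)).
  apply: (@measurable_bounded_integrable _ (measurableTypeR R)) => //.
    by rewrite /= lebesgue_measure_itv/=; case: ifP => //; rewrite ltry.
  exists `|k|; split; first exact: num_real.
  by move=> M' kM' x _ /=; exact: ltW.
have iD : mu.-integrable `[a, b] (EFin \o (fun x => q x - c)).
  by apply: eq_integrable (integrableB _ iq (icst c)).
have <- : \int[mu]_(x in `[a, b]) (q x - c)
    = \int[mu]_(x in `[a, b]) q x - (b - a) * c.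
  by rewrite RintegralB// Rintegral_cst// muab mulrC.
apply: (le_trans (le_normr_Rintegral _ iD)) => //.
rewrite -muab -Rintegral_cst//; apply: le_Rintegral => //.
  exact: integrable_norm.
Qed.

Lemma lipschitz_integrable (g : R -> R) T K : 0 <= T ->
  (forall s t, 0 <= s <= T -> 0 <= t <= T -> `|g s - g t| <= K * `|s - t|) ->
  mu.-integrable `[0, T] (EFin \o g).
Proof.
move=> T0 lipg; apply: continuous_compact_integrable; first exact: segment_compact.
apply/subspace_continuousP => x xT; apply/cvgrPdist_lt => e e0.
have K0 : 0 < `|K| + 1 by rewrite ltr_wpDl.
rewrite near_withinE; near=> y => yT.
rewrite (le_lt_trans (lipg _ _ xT yT))// (@le_lt_trans _ _ ((`|K| + 1) * `|x - y|))//.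
  by rewrite ler_wpM2r// (le_trans (ler_norm K))// lerDl.
rewrite mulrC -ltr_pdivlMr//; near: y.
by apply: cvgr_dist_lt; rewrite ?divr_gt0//; exact: cvg_id.
Unshelve. all: by end_near. Qed.

(** The last hypothesis says that f (ds + dt) has integral 0 around the rectangle
[0,s] x [0,t].  Its potential W has both partial derivatives equal to f, so W is
constant along each antidiagonal s + t = T', and comparing the two ends gives equal
integrals of f(0,.) and f(.,0) over [0,T'].  Letting T' vary near T gives the equality
of the integrands at T. *)
Lemma antidiagonal_endpoints (f : R -> R -> R) T K : 0 < T ->
  (forall s s' t, 0 <= s <= T -> 0 <= s' <= T -> 0 <= t <= T ->
     `|f s t - f s' t| <= K * `|s - s'|) ->
  (forall s t t', 0 <= s <= T -> 0 <= t <= T -> 0 <= t' <= T ->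
     `|f s t - f s t'| <= K * `|t - t'|) ->
  (forall s t, 0 <= s <= T -> 0 <= t <= T ->
     \int[mu]_(b in `[0, t]) f s b - \int[mu]_(b in `[0, t]) f 0 b =
     \int[mu]_(r in `[0, s]) f r t - \int[mu]_(r in `[0, s]) f r 0) ->
  f 0 T = f T 0.
Proof.
move=> T0 lip1 lip2 clos.
have K0 : 0 <= K.
  have := lip1 T 0 0; rewrite !lexx (ltW T0) subr0 (gtr0_norm T0) => /(_ isT isT isT).
  by move=> /(le_trans (normr_ge0 _)); rewrite pmulr_lge0.
have T00 : (0 : R) <= 0 <= T by apply/andP; split=> //; exact: ltW.
have int1 t : 0 <= t <= T -> mu.-integrable `[0, T] (EFin \o f^~ t).
  move=> tT; apply: (@lipschitz_integrable _ _ K); rewrite ?ltW// => x y xT yT.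
  exact: lip1.
have int2 s : 0 <= s <= T -> mu.-integrable `[0, T] (EFin \o f s).
  move=> sT; apply: (@lipschitz_integrable _ _ K); rewrite ?ltW// => x y xT yT.
  exact: lip2.
have main T' : 0 <= T' -> T' <= T ->
    \int[mu]_(b in `[0, T']) f 0 b = \int[mu]_(r in `[0, T']) f r 0.
  move=> T'0 T'T.
  pose W s t := \int[mu]_(b in `[0, t]) f s b + \int[mu]_(r in `[0, s]) f r 0.
  have WE s t : 0 <= s <= T -> 0 <= t <= T ->
      W s t = \int[mu]_(b in `[0, t]) f 0 b + \int[mu]_(r in `[0, s]) f r t.
    move=> sT tT; move/eqP: (clos s t sT tT).
    by rewrite subr_eq /W => /eqP ->; ring.
  pose phi t := W (T' - t) t.
  suff H e : 0 < e -> `|phi T' - phi 0| <= e * T' - e * 0.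
    have : phi T' = phi 0.
      apply/eqP; rewrite -subr_eq0 -normr_le0; apply/ler_addgt0Pr => e e0.
      rewrite add0r.
      have d0 : 0 < e / (T' + 1) by rewrite divr_gt0// ltr_wpDl.
      apply: (le_trans (H _ d0)).
      rewrite mulr0 subr0 -mulrA ler_piMr// ?(ltW e0)//.
      by rewrite mulrC ler_pdivrMr ?ltr_wpDl// mul1r lerDl.
    by rewrite /phi /W subrr subr0 !set_itv1 !Rintegral_set1 addr0 add0r.
  move=> e0; apply: (@local_increment_le _ phi (fun t => e * t)) => //.
    by move=> x y _ _ xy; rewrite ler_pM2l.
  (* Both one-variable increments of W differ from (y - t) f(T' - y, t) by O((y - t)^2). *)
  have key t y : 0 <= t -> t <= y -> y <= T' ->
      `|phi y - phi t| <= (K * (y - t)) * (y - t) + (K * (y - t)) * (y - t).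
    move=> t0 ty yT'.
    have tT : 0 <= t <= T by rewrite t0 (le_trans ty (le_trans yT' T'T)).
    have yT : 0 <= y <= T by rewrite (le_trans t0 ty) (le_trans yT' T'T).
    have sT : 0 <= T' - y <= T by apply/andP; split; lra.
    have sT' : 0 <= T' - t <= T by apply/andP; split; lra.
    have e1 : phi y - W (T' - y) t = \int[mu]_(b in `[t, y]) f (T' - y) b.
      rewrite /phi /W (@Rintegral_itv_cat _ _ 0 t y)//; first by ring.
      apply: integrable_sub_itv (int2 _ sT) => //; first by case/andP: yT.
    have e2 : phi t - W (T' - y) t
        = \int[mu]_(r in `[T' - y, T' - t]) f r t.
      rewrite /phi !WE// (@Rintegral_itv_cat _ _ 0 (T' - y) (T' - t))//.
      - by ring.
      - by case/andP: sT.
      - by lra.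
      - by apply: integrable_sub_itv (int1 _ tT) => //; case/andP: sT'.
    have i1 : mu.-integrable `[t, y] (EFin \o f (T' - y)).
      by apply: integrable_sub_itv (int2 _ sT) => //; case/andP: yT.
    have i2 : mu.-integrable `[T' - y, T' - t] (EFin \o f^~ t).
      apply: integrable_sub_itv (int1 _ tT) => //; first by case/andP: sT.
      by case/andP: sT'.
    have b1 := @Rintegral_near_cst _ _ _ (f (T' - y) t) (K * (y - t)) ty i1.
    have b2 := @Rintegral_near_cst _ _ _ (f (T' - y) t) (K * (y - t)) _ i2.
    rewrite -e1 in b1; rewrite -e2 in b2.
    have l12 : y - t = T' - t - (T' - y) by ring.
    rewrite -l12 in b2.
    have -> : phi y - phi t = (phi y - W (T' - y) t - (y - t) * f (T' - y) t)
        - (phi t - W (T' - y) t - (y - t) * f (T' - y) t) by ring.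
    rewrite (le_trans (ler_normB _ _))// lerD//.
      apply: b1 => x /andP[tx xy]; apply: (le_trans (lip2 _ _ _ sT _ tT)).
        by rewrite (le_trans t0 tx) (le_trans xy)//; case/andP: yT.
      rewrite ler_wpM2l// ger0_norm ?subr_ge0//; lra.
    apply: b2; first by lra.
    move=> x /andP[yx xt]; apply: (le_trans (lip1 _ _ _ _ sT tT)).
      apply/andP; split; first by apply: le_trans yx; case/andP: sT.
      by apply: (le_trans xt); case/andP: sT'.
    by rewrite ler_wpM2l// ger0_norm ?subr_ge0//; lra.
  move=> t /andP[t0 tT'].
  have d0 : 0 < e / (K + K + 1) by rewrite divr_gt0// ltr_wpDl ?addr_ge0.
  exists (e / (K + K + 1)) => // y /andP[y0 yT'] ytd.
  have fin a b : 0 <= b - a -> b - a < e / (K + K + 1) ->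
      K * (b - a) * (b - a) + K * (b - a) * (b - a) <= `|e * (b - a)|.
    move=> ab abd; rewrite -mulrDl -mulrDl normrM (ger0_norm ab) ler_wpM2r//.
    rewrite (gtr0_norm e0) -(ler_pM2l (_ : 0 < (K + K + 1)^-1)) ?invr_gt0 ?ltr_wpDl ?addr_ge0//.
    rewrite [leRHS]mulrC; apply: le_trans (ltW abd).
    rewrite mulrA ler_piMl// mulrC ler_pdivrMr ?mul1r ?ltr_wpDl ?addr_ge0//.
    by rewrite lerDl.
  have [ty|yt] := leP t y.
    apply: (le_trans (key _ _ t0 ty yT')); rewrite -mulrBr; apply: fin.
      by rewrite subr_ge0.
    by rewrite ger0_norm ?subr_ge0// in ytd.
  rewrite distrC [leRHS]distrC.
  apply: (le_trans (key _ _ y0 (ltW yt) tT')); rewrite -mulrBr; apply: fin.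
    by rewrite subr_ge0 ltW.
  by rewrite distrC ger0_norm ?subr_ge0// ltW in ytd.
have TT : 0 <= T <= T by rewrite ltW /=.
suff H d : 0 < d -> d <= T -> `|f 0 T - f T 0| <= (K + K) * d.
  apply/eqP; rewrite -subr_eq0 -normr_le0; apply/ler_addgt0Pr => e e0.
  rewrite add0r.
  have d0 : 0 < e / (K + K + 1) by rewrite divr_gt0// ltr_wpDl ?addr_ge0.
  pose d := Num.min T (e / (K + K + 1)).
  have dpos : 0 < d by rewrite lt_min T0.
  have dT : d <= T by rewrite ge_min lexx.
  apply: (le_trans (H d dpos dT)).
  have de : d <= e / (K + K + 1) by rewrite ge_min lexx orbT.
  apply: (@le_trans _ _ ((K + K) * (e / (K + K + 1)))).
    by rewrite ler_wpM2l ?addr_ge0.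
  rewrite mulrCA ler_piMr ?(ltW e0)// ler_pdivrMr ?mul1r ?lerDl//.
  by rewrite ltr_wpDl ?addr_ge0.
move=> d0 dT.
have TdT : 0 <= T - d <= T by apply/andP; split; lra.
case/andP: (TdT) => Td0 TdT'.
have m1 := main T (ltW T0) (lexx T).
have m2 := main (T - d) Td0 TdT'.
rewrite (@Rintegral_itv_cat _ (f 0) 0 (T - d) T)// in m1; last exact: int2.
rewrite (@Rintegral_itv_cat _ (f^~ 0) 0 (T - d) T)// in m1; last exact: int1.
rewrite m2 in m1; move/addrI in m1.
have i1 : mu.-integrable `[T - d, T] (EFin \o f 0).
  by apply: integrable_sub_itv (int2 0 T00).
have i2 : mu.-integrable `[T - d, T] (EFin \o f^~ 0).
  by apply: integrable_sub_itv (int1 0 T00).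
have b1 := @Rintegral_near_cst _ _ _ (f 0 T) (K * d) TdT' i1.
have b2 := @Rintegral_near_cst _ _ _ (f T 0) (K * d) TdT' i2.
have l12 : T - (T - d) = d by ring.
rewrite l12 in b1 b2; rewrite m1 in b1.
have {}b1 := b1 _; have {}b2 := b2 _.
have itvT x : T - d <= x <= T -> 0 <= x <= T /\ `|x - T| <= d.
  move=> /andP[xd xT]; split; first by rewrite (le_trans Td0 xd) xT.
  by rewrite ler0_norm ?subr_le0// opprB lerBlDr -lerBlDl.
have h1 : forall x, T - d <= x <= T -> `|f 0 x - f 0 T| <= K * d.
  move=> x /itvT[xT xd]; apply: (le_trans (lip2 _ _ _ T00 xT TT)).
  by rewrite ler_wpM2l.
have h2 : forall x, T - d <= x <= T -> `|f x 0 - f T 0| <= K * d.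
  move=> x /itvT[xT xd]; apply: (le_trans (lip1 _ _ _ xT TT T00)).
  by rewrite ler_wpM2l.
move: (b1 h1) (b2 h2); set J := Rintegral _ _ _ => c1 c2.
rewrite -(ler_pM2l d0) -[X in X * `|_|](gtr0_norm d0) -normrM mulrBr.
have -> : d * f 0 T - d * f T 0 = (J - d * f T 0) - (J - d * f 0 T) by ring.
apply: (le_trans (ler_normB _ _)).
apply: (le_trans (lerD c2 c1)).
by rewrite le_eqVlt; apply/orP; left; apply/eqP; ring.
Qed.

End antidiagonal.

(** * Joint measurability, Fubini and dominated convergence *)

Section joint_measurability.
Context {R : realType} {d} {Z : measurableType d}.
Notation mu := (@lebesgue_measure R).

(** Stated with sequences that may stay at [t], so that dominated convergence shows
directly that an expectation of right-continuous functions is right-continuous. *)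
Definition right_continuous (g : R -> R) := forall t (u : nat -> R),
  (forall n, t <= u n) -> u @ \oo --> t -> (g \o u) @ \oo --> g t.

(** Right continuity in t makes g(t,z) the limit of g(u_n(t),z), where u_n(t) is the
first multiple of 1/(n+1) strictly above t; as u_n takes countably many values, the
approximations are jointly measurable. *)
Lemma measurable_fun_right_continuous (g : R -> Z -> R) :
  (forall t, measurable_fun setT (g t)) ->
  (forall z, right_continuous (g^~ z)) ->
  measurable_fun setT (fun x : Z * measurableTypeR R => g x.2 x.1).
Proof.
move=> mg rcg.
pose a (n : nat) (k : int) : R := (k + 1)%:~R / n.+1%:R.
pose u (n : nat) (t : R) : R := a n (Num.floor (t * n.+1%:R)).
have n0 n : 0 < n.+1%:R :> R by rewrite ltr0n.
have tu n t : t <= u n t.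
  rewrite /u /a ler_pdivlMr//; apply: ltW.
  by case/andP: (floor_itv (t * n.+1%:R)).
have ut n t : u n t <= t + n.+1%:R^-1.
  rewrite /u /a ler_pdivrMr// mulrDl mulVf ?gt_eqF// intrD lerD2r.
  by case/andP: (floor_itv (t * n.+1%:R)).
apply: (@measurable_fun_cvg _ _ _ _ (fun n x => g (u n x.2) x.1)); last first.
  move=> [z t] _ /=; apply: (rcg z t (u^~ t)) => //.
  apply: (@squeeze_cvgr _ _ _ _ (fun=> t) (fun n => t + n.+1%:R^-1)).
  - by near=> n; rewrite tu ut.
  - exact: cvg_cst.
  - rewrite -[X in _ --> X]addr0; apply: cvgD; first exact: cvg_cst.
    exact: cvg_harmonic.
move=> n _ B mB; rewrite setTI.
have -> : (fun x : Z * measurableTypeR R => g (u n x.2) x.1) @^-1` B =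
    \bigcup_(k : int) ((g (a n k) @^-1` B) `*`
                        [set t : R | Num.floor (t * n.+1%:R) = k]).
  apply/seteqP; split=> [[z t] /= Bg|[z t] /= [k _ [/= Bg kE]]]; last by rewrite /u kE.
  by exists (Num.floor (t * n.+1%:R)).
apply: countable_bigcupT_measurable => // k; apply: measurableX.
  by have := mg (a n k) measurableT B mB; rewrite setTI.
rewrite (_ : [set _ | _] = `[k%:~R / n.+1%:R, (k + 1)%:~R / n.+1%:R[%classic)//.
apply/seteqP; split=> t /=; rewrite in_itv/= ler_pdivrMr// ltr_pdivlMr//.
  by move=> <-; exact: floor_itv.
exact: floor_def.
Unshelve. all: by end_near. Qed.

End joint_measurability.

Section fubini_bounded.
Context {R : realType} {d} {Z : measurableType d}.
Notation mu := (@lebesgue_measure R).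
Variables (m : {sigma_finite_measure set Z -> \bar R}).
Variables (A : set (measurableTypeR R)) (g : Z * measurableTypeR R -> R) (C : R).
Hypothesis mA : measurable A.
Hypothesis Afin : (mu A < +oo)%E.
Hypothesis mg : measurable_fun setT g.
Hypothesis gC : forall r, A r -> (\int[m]_z `|(g (z, r))%:E| <= C%:E)%E.

Let f (x : Z * measurableTypeR R) : \bar R := (g x * \1_A x.2)%:E.

Let mf : measurable_fun setT f.
Proof.
apply/measurable_EFinP; apply: measurable_funM => //.
by apply: measurableT_comp; [exact: measurable_indic|exact: measurable_snd].
Qed.

Let if_ : (m \x mu)%E.-integrable setT f.
Proof.
apply/integrable21ltyP => //.
apply: (@le_lt_trans _ _ (\int[mu]_(x in A) C%:E)%E); last first.
  rewrite integral_cst//; have C0 : (0 <= C%:E)%E \/ A = set0.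
    have [->|/set0P[r Ar]] := eqVneq A set0; first by right.
    by left; apply: le_trans (gC r Ar); exact: integral_ge0.
  case: C0 => [C0|->]; last by rewrite measure0 mule0.
  by rewrite lte_mul_pinfty.
rewrite [leRHS]integral_mkcond; apply: ge0_le_integral => //.
- by move=> *; exact: integral_ge0.
- exact: (measurable_fun_fubini_tonelli_G (fun x => `|f x|)%E (measurableT_comp _ mf)).
- apply/(measurable_restrictT _ mA) => //.
- move=> r _; rewrite patchE; case: ifPn => rA.
    rewrite inE in rA; apply: le_trans (gC r rA).
    by rewrite le_eqVlt; apply/orP; left; apply/eqP; apply: eq_integral => z _;
      rewrite /f/= indicE mem_set// mulr1.
  by rewrite integral0_eq// => z _; rewrite /f/= indicE (negbTE rA) mulr0 normr0.
Qed.

Let sectionE z : (\int[mu]_r f (z, r) = \int[mu]_(r in A) (g (z, r))%:E)%E.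
Proof.
rewrite [RHS]integral_mkcond; apply: eq_integral => r _.
by rewrite /f patchE indicE/=; case: ifPn => _; rewrite ?mulr1// mulr0.
Qed.

Let fin_section : {ae m, forall z, (\int[mu]_(r in A) (g (z, r))%:E)%E \is a fin_num}.
Proof.
have := integrable_ae measurableT (integrable_fubini_F if_).
by apply: filterS => z /(_ I); rewrite /fubini_F sectionE.
Qed.

Lemma measurable_Rintegral_section :
  measurable_fun setT (fun z => \int[mu]_(r in A) g (z, r)).
Proof.
apply: measurableT_comp => //.
have := measurable_fubini_F if_.
by apply: eq_measurable_fun => z _; rewrite /fubini_F sectionE.
Qed.

(** The real-valued integral is 0 where the integral diverges, hence it is always
dominated by the extended one. *)
Lemma integrable_Rintegral_section :
  m.-integrable setT (fun z => (\int[mu]_(r in A) g (z, r))%:E).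
Proof.
have iG := integrable_fubini_F if_.
apply: (le_integrable measurableT _ _ iG) => //.
  by apply/measurable_EFinP; exact: measurable_Rintegral_section.
move=> z _; rewrite /fubini_F sectionE /Rintegral.
have fine_le (x : \bar R) : (`|(fine x)%:E| <= `|x|)%E.
  by case: x => [r| |] //=; rewrite normr0 leey.
exact: fine_le.
Qed.

(** The inner integral over [A] may diverge for some z; this happens on a null set
only, because g is integrable for the product measure. *)
Lemma Rintegral_fubini :
  \int[m]_z \int[mu]_(r in A) g (z, r) = \int[mu]_(r in A) \int[m]_z g (z, r).
Proof.
rewrite /Rintegral; congr fine.
transitivity (\int[m]_z \int[mu]_r f (z, r))%E.
  apply: ae_eq_integral => //.
  - by apply/measurable_EFinP; exact: measurable_Rintegral_section.
  - exact: (measurable_fubini_F if_).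
  by apply: filterS fin_section => z hz _; rewrite sectionE fineK.
rewrite Fubini// [RHS]integral_mkcond; apply: eq_integral => r _.
rewrite patchE; case: ifPn => rA.
  rewrite inE in rA; rewrite fineK.
    by apply: eq_integral => z _; rewrite /f/= indicE mem_set// mulr1.
  apply: integrable_fin_num => //; apply/integrableP; split.
    apply/measurable_EFinP; exact: (measurable_fun_pair1 _ mg).
  by apply: le_lt_trans (gC r rA) _; exact: ltry.
by rewrite integral0_eq// => z _; rewrite /f/= indicE (negbTE rA) mulr0.
Qed.

End fubini_bounded.

Section dominated_convergence_real.
Context {R : realType} {d} {Z : measurableType d}.

Lemma cvg_Rintegral_dominated (m : {measure set Z -> \bar R}) (D : set Z)
    (f_ : nat -> Z -> R) (f : Z -> R) (G : Z -> \bar R) :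
  measurable D ->
  (forall n, measurable_fun D (f_ n)) -> measurable_fun D f ->
  {ae m, forall z, D z -> f_ n z @[n --> \oo] --> f z} ->
  m.-integrable D G ->
  {ae m, forall z n, D z -> (`|(f_ n z)%:E| <= G z)%E} ->
  (\int[m]_(z in D) f_ n z) @[n --> \oo] --> \int[m]_(z in D) f z.
Proof.
move=> mD mf_ mf f_f iG f_G.
have [||||if_ _] := @dominated_convergence _ _ _ m D mD
    (fun n => EFin \o f_ n) (EFin \o f) G _ _ _ iG _ => //.
- by move=> n; apply/measurable_EFinP.
- exact/measurable_EFinP.
- by apply: filterS f_f => z fz Dz; apply: cvg_EFin; [exact: nearW|exact: fz].
have fin_if := integrable_fin_num mD if_.
rewrite -[X in _ --> X -> _](fineK fin_if).
by move/fine_cvg.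
Qed.

End dominated_convergence_real.

Section measurable_section_integral.
Context {R : realType} {d1 d2} {Z1 : measurableType d1} {Z2 : measurableType d2}.

(** Both halves of the integral are measurable by Tonelli, whatever their values. *)
Lemma measurable_fun_Rintegral_section
    (m : {sigma_finite_measure set Z1 -> \bar R}) (g : Z1 * Z2 -> R) :
  measurable_fun setT g ->
  measurable_fun setT (fun y => \int[m]_x g (x, y)).
Proof.
move=> mg; apply: measurableT_comp => //.
have mEg : measurable_fun setT (EFin \o g) by exact/measurable_EFinP.
have mp := measurable_fun_fubini_tonelli_G (m1 := m) _ (measurable_funepos mEg).
have mn := measurable_fun_fubini_tonelli_G (m1 := m) _ (measurable_funeneg mEg).
have := emeasurable_funB (mp _) (mn _).
move=> /(_ (fun=> funepos_ge0 _ _) (fun=> funeneg_ge0 _ _)).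
apply: eq_measurable_fun => y _; rewrite [RHS]integralE.
by congr (_ - _)%E; apply: eq_integral => x _; rewrite !unlock.
Qed.

End measurable_section_integral.

Section common_density.
Context {R : realType}.
Notation mu := (@lebesgue_measure R).
Variables (f h : R -> R -> R) (T C : R).

Hypothesis T0 : 0 < T.
Hypothesis mh : measurable_fun setT
  (fun x : measurableTypeR R * measurableTypeR R => h x.1 x.2).
Hypothesis hC : forall s t, `|h s t| <= C.
Hypothesis f_first : forall s t, 0 <= s <= T ->
  f s t - f 0 t = \int[mu]_(r in `[0, s]) h r t.
Hypothesis f_second : forall s t, 0 <= s <= T -> 0 <= t <= T ->
  f s t - f s 0 = \int[mu]_(r in `[0, t]) h s r.

Let mu_itv_fin (a b : R) : (mu `[a, b]%classic < +oo)%E.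
Proof. by rewrite lebesgue_measure_itv/=; case: ifP => _; rewrite ltry. Qed.

Let ih1 t a b : mu.-integrable `[a, b] (fun s => (h s t)%:E).
Proof.
apply: (@measurable_bounded_integrable _ (measurableTypeR R)) => //.
- exact: mu_itv_fin.
- apply: measurable_funTS.
  exact: (measurable_fun_pair1 (t : measurableTypeR R) mh).
- exists C; split; first exact: num_real.
  by move=> M CM x _ /=; apply: le_trans (ltW CM).
Qed.

Let ih2 s a b : mu.-integrable `[a, b] (fun t => (h s t)%:E).
Proof.
apply: (@measurable_bounded_integrable _ (measurableTypeR R)) => //.
- exact: mu_itv_fin.
- apply: measurable_funTS.
  exact: (measurable_fun_pair2 (s : measurableTypeR R) mh).
- exists C; split; first exact: num_real.
  by move=> M CM x _ /=; apply: le_trans (ltW CM).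
Qed.

Let lip (F k : R -> R) : (forall a b, mu.-integrable `[a, b] (EFin \o k)) ->
  (forall x, `|k x| <= C) ->
  (forall s, 0 <= s <= T -> F s - F 0 = \int[mu]_(r in `[0, s]) k r) ->
  forall s s', 0 <= s <= T -> 0 <= s' <= T -> `|F s - F s'| <= C * `|s - s'|.
Proof.
move=> ik kC Fk.
have le_case s s' : 0 <= s <= T -> 0 <= s' <= T -> s <= s' ->
    `|F s' - F s| <= C * `|s' - s|.
  move=> sT s'T ss'.
  have -> : F s' - F s = \int[mu]_(r in `[s, s']) k r - (s' - s) * 0.
    have -> : F s' - F s = (F s' - F 0) - (F s - F 0) by ring.
    rewrite !Fk// (@Rintegral_itv_cat _ k 0 s s')//; first by ring.
    by case/andP: sT.
  rewrite (ger0_norm (_ : 0 <= s' - s)) ?subr_ge0//.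
  by apply: Rintegral_near_cst => // x _; rewrite subr0.
move=> s s' sT s'T; have [ss'|/ltW s's] := leP s s'; last exact: le_case.
by rewrite distrC [X in _ * X]distrC; exact: le_case.
Qed.

(** Fubini for h on [0,s] x [0,t] is the closedness needed by
[antidiagonal_endpoints], and the bound on h makes f Lipschitz. *)
Lemma common_density_endpoints : f 0 T = f T 0.
Proof.
have lip1 s s' t : 0 <= s <= T -> 0 <= s' <= T -> 0 <= t <= T ->
    `|f s t - f s' t| <= C * `|s - s'|.
  move=> sT s'T _.
  exact: (lip (f^~ t) (h^~ t) (ih1 t) (hC^~ t) (fun s => f_first s t)).
have lip2 s t t' : 0 <= s <= T -> 0 <= t <= T -> 0 <= t' <= T ->
    `|f s t - f s t'| <= C * `|t - t'|.
  move=> sT tT t'T.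
  exact: (lip (f s) (h s) (ih2 s) (hC s) (fun t => f_second s t sT)).
apply: (@antidiagonal_endpoints _ f T C) => // s t sT tT.
have T00 : (0 : R) <= 0 <= T by apply/andP; split=> //; exact: ltW.
have if1 t' : 0 <= t' <= T -> mu.-integrable `[0, s] (EFin \o f^~ t').
  move=> t'T; case/andP: sT => s0 sT.
  apply: (@integrable_sub_itv _ _ 0 T) => //.
  apply: (@lipschitz_integrable _ _ _ C); rewrite ?ltW// => x y xT yT.
  exact: lip1.
have if2 s' : 0 <= s' <= T -> mu.-integrable `[0, t] (EFin \o f s').
  move=> s'T; case/andP: tT => t0 tT.
  apply: (@integrable_sub_itv _ _ 0 T) => //.
  apply: (@lipschitz_integrable _ _ _ C); rewrite ?ltW// => x y xT yT.
  exact: lip2.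
rewrite -!RintegralB//; [|exact: if1|exact: if1|exact: if2|exact: if2].
under eq_Rintegral do rewrite f_first//.
under [RHS]eq_Rintegral => x xs.
  rewrite f_second//; last first.
    rewrite inE/= in_itv/= in xs; case/andP: xs => x0 xs.
    by rewrite x0 (le_trans xs)//; case/andP: sT.
  over.
pose g (x : measurableTypeR R * measurableTypeR R) :=
  h x.2 x.1 * \1_(`[0, t]%classic : set (measurableTypeR R)) x.1.
have mg : measurable_fun setT g.
  apply: measurable_funM.
    have ms : measurable_fun setT
        (fun x : measurableTypeR R * measurableTypeR R => (x.2, x.1)).
      by apply: measurable_fun_pair; [exact: measurable_snd|exact: measurable_fst].
    exact: (measurableT_comp mh ms).
  by apply: measurableT_comp; [exact: measurable_indic|exact: measurable_fst].
have gE b r : g (b, r) = ((fun b => h r b) \_ `[0, t]) b.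
  rewrite /g [LHS]/= patchE indicE; case: ifPn => _; first exact: mulr1.
  exact: mulr0.
have gC r : `[0, s]%classic r -> (\int[mu]_z `|(g (z, r))%:E| <= (C * t)%:E)%E.
  move=> _.
  have -> : (\int[mu]_z `|(g (z, r))%:E| = \int[mu]_(b in `[0%R, t]) `|(h r b)%:E|)%E.
    rewrite [RHS]integral_mkcond; apply: eq_integral => b _.
    rewrite gE !patchE; case: ifPn => _; first exact: erefl.
    exact: abse0.
  apply: (@le_trans _ _ (\int[mu]_(b in `[0%R, t]) C%:E)%E).
    apply: ge0_le_integral => //.
    - by apply: measurableT_comp => //; exact: measurable_int (ih2 r 0 t).
    - by move=> b _; rewrite lee_fin.
  rewrite integral_cst//= lebesgue_measure_itv/= lte_fin.
  case/andP: tT => t0 _; case: ltP => t0'; first by rewrite sube0 EFinM.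
  by rewrite mule0 lee_fin mulr_ge0// (le_trans (normr_ge0 _) (hC 0 0)).
have mI : measurable (`[0, s]%classic : set (measurableTypeR R)) by [].
have fub := @Rintegral_fubini R _ (measurableTypeR R) mu _
  g (C * t) mI (mu_itv_fin 0 s) mg gC.
transitivity (\int[mu]_z \int[mu]_(r in `[0, s]) g (z, r)).
  rewrite Rintegral_mkcond; apply: eq_Rintegral => z _; rewrite patchE.
  case: ifPn => zt.
    by apply: eq_Rintegral => r _; rewrite gE patchE zt.
  transitivity (\int[mu]_(r in `[0, s]) (fun=> 0 : R) r).
    rewrite Rintegral_cst; [exact/esym/mul0r|exact: mI].
  by apply: eq_Rintegral => r _; rewrite gE patchE (negbTE zt).
rewrite fub; apply: eq_Rintegral => r _.
rewrite [RHS]Rintegral_mkcond; apply: eq_Rintegral => b _.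
exact: gE.
Qed.

End common_density.

Section exchange.
Context {R : realType} d (Omega : measurableType d) (P : probability Omega R).
Notation mu := (@lebesgue_measure R).
Variables (e H : R -> R -> Omega -> R) (T C : R) (G : R -> Omega -> \bar R).

Hypothesis T0 : 0 < T.
Hypothesis ie : forall s t, P.-integrable setT (EFin \o e s t).
Hypothesis mH : forall t,
  measurable_fun setT (fun x : Omega * measurableTypeR R => H x.2 t x.1).
Hypothesis rcH : forall s w, right_continuous (fun t => H s t w).
Hypothesis HC : forall s t, (\int[P]_w `|(H s t w)%:E| <= C%:E)%E.
Hypothesis iG : forall s, P.-integrable setT (G s).
Hypothesis HG : forall s t w, (`|(H s t w)%:E| <= G s w)%E.
Hypothesis e_first : forall s t w, 0 <= s <= T ->
  e s t w - e 0 t w = \int[mu]_(r in `[0, s]) H r t w.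
Hypothesis e_second : forall s t, 0 <= s <= T -> 0 <= t <= T ->
  \int[P]_w (e s t w - e s 0 w - \int[mu]_(r in `[0, t]) H s r w) = 0.

Let f s t := \int[P]_w e s t w.
Let h s t := \int[P]_w H s t w.

Let mHw s t : measurable_fun setT (H s t).
Proof. exact: (measurable_fun_pair1 s (mH t)). Qed.

Let iH s t : P.-integrable setT (EFin \o H s t).
Proof.
apply/integrableP; split; first exact/measurable_EFinP.
by apply: le_lt_trans (HC s t) _; exact: ltry.
Qed.

Let mu_itv_fin (a b : R) : (mu `[a, b]%classic < +oo)%E.
Proof. by rewrite lebesgue_measure_itv/=; case: ifP => _; rewrite ltry. Qed.

Let f_first s t : 0 <= s <= T -> f s t - f 0 t = \int[mu]_(r in `[0, s]) h r t.
Proof.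
move=> sT; rewrite /f -RintegralB//.
under eq_Rintegral do rewrite e_first//.
have mI : measurable (`[0, s]%classic : set (measurableTypeR R)) by [].
exact: (@Rintegral_fubini R _ Omega P _ (fun x => H x.2 t x.1) C
  mI (mu_itv_fin 0 s) (mH t) (fun r _ => HC r t)).
Qed.

Let mH2 s : measurable_fun setT (fun x : Omega * measurableTypeR R => H s x.2 x.1).
Proof. exact: (measurable_fun_right_continuous (H s) (mHw s) (rcH s)). Qed.

Let f_second s t : 0 <= s <= T -> 0 <= t <= T ->
  f s t - f s 0 = \int[mu]_(r in `[0, t]) h s r.
Proof.
move=> sT tT; apply/eqP; rewrite -subr_eq0 /f -RintegralB//.
have mI : measurable (`[0, t]%classic : set (measurableTypeR R)) by [].
have fub := @Rintegral_fubini R _ Omega P _ (fun x => H s x.2 x.1) C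
  mI (mu_itv_fin 0 t) (mH2 s) (fun r _ => HC s r).
rewrite -[X in _ - X]fub -RintegralB//.
- by apply/eqP; exact: e_second.
- have := integrableB measurableT (ie s t) (ie s 0).
  by apply: eq_integrable.
- exact: (@integrable_Rintegral_section R _ Omega P _
    (fun x => H s x.2 x.1) C mI (mu_itv_fin 0 t) (mH2 s) (fun r _ => HC s r)).
Qed.

Let hC s t : `|h s t| <= C.
Proof.
rewrite -lee_fin; apply: le_trans (HC s t).
rewrite /h EFin_normr_Rintegral//; apply: le_abse_integral => //.
exact/measurable_EFinP.
Qed.

Let mh1 t : measurable_fun setT (fun s : measurableTypeR R => h s t).
Proof. exact: (@measurable_fun_Rintegral_section _ _ _ _ _ P _ (mH t)). Qed.

Let mh : measurable_fun setT
  (fun x : measurableTypeR R * measurableTypeR R => h x.1 x.2).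
Proof.
apply: (measurable_fun_right_continuous (fun t (s : measurableTypeR R) => h s t)) => // s t u tu ut.
apply: (@cvg_Rintegral_dominated _ _ _ _ _ _ _ (G s)) => //.
- by apply: aeW => w _; exact: rcH.
- by apply: aeW => w n _; exact: HG.
Qed.

(** Taking expectations in the pathwise identity [e_first] and in the centred process
[e_second] makes the expectation of H the density of the expectation of e in both
variables. *)
Lemma expectation_exchange : f 0 T = f T 0.
Proof. exact: (common_density_endpoints f h T C T0 mh hC f_first f_second). Qed.

End exchange.

(** * Convergence and absolute continuity of the pairing *)

Section complex_components.
Context {R : realType}.
Implicit Types z : R[i].

(** Real and imaginary parts under one name, so that each real statement is proved once
for both. *)
Definition cpart (b : bool) z : R := if b then complex.Re z else complex.Im z.

Lemma cpartD b z1 z2 : cpart b (z1 + z2) = cpart b z1 + cpart b z2.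
Proof. by case: b z1 z2 => -[a c] [a' c']. Qed.

Lemma cpartN b z : cpart b (- z) = - cpart b z.
Proof. by case: b z => -[a c]. Qed.

Lemma cpartB b z1 z2 : cpart b (z1 - z2) = cpart b z1 - cpart b z2.
Proof. by rewrite cpartD cpartN. Qed.

Lemma cpart_sum b (I : Type) (r : seq I) (p : pred I) (F : I -> R[i]) :
  cpart b (\sum_(i <- r | p i) F i) = \sum_(i <- r | p i) cpart b (F i).
Proof.
elim/big_rec2: _ => [|i y1 y2 _ <-]; first by case: b.
by rewrite cpartD.
Qed.

Lemma cpartMr b z (r : R) : cpart b (z * r%:C) = cpart b z * r.
Proof. by case: b z => -[a c] /=; rewrite mulr0 ?subr0 ?add0r. Qed.

Lemma cpart_inj z1 z2 : (forall b, cpart b z1 = cpart b z2) -> z1 = z2.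
Proof.
case: z1 z2 => [a c] [a' c'] h.
by move: (h true) (h false) => /= -> ->.
Qed.

Lemma cmodE z : (cmod z)%:C = `|z|.
Proof. by rewrite /cmod normc_def. Qed.

Lemma cmod_ge0 z : 0 <= cmod z.
Proof. by rewrite /cmod normc_def /= sqrtr_ge0. Qed.

Lemma le_cpart_cmod b z : `|cpart b z| <= cmod z.
Proof.
rewrite /cmod normc_def /= -sqrtr_sqr ler_wsqrtr//.
by case: b; rewrite /= ?lerDl ?lerDr sqr_ge0.
Qed.

Lemma cmod_le_cpart z : cmod z <= `|cpart true z| + `|cpart false z|.
Proof.
rewrite /cmod normc_def /= -[leRHS]ger0_norm ?addr_ge0//.
rewrite -sqrtr_sqr ler_wsqrtr// sqrrD !real_normK ?num_real//.
by rewrite -addrA [X in _ <= _ + X]addrC addrA lerDl mulrn_wge0// mulr_ge0.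
Qed.

Lemma cmod0 : cmod (0 : R[i]) = 0.
Proof. by rewrite /cmod normr0. Qed.

Lemma cmod_sum (I : Type) (r : seq I) (p : pred I) (F : I -> R[i]) :
  cmod (\sum_(i <- r | p i) F i) <= \sum_(i <- r | p i) cmod (F i).
Proof.
rewrite -lecR cmodE; apply: le_trans (ler_norm_sum _ _ _) _.
rewrite (eq_bigr (fun i => (cmod (F i))%:C)); last by move=> i _; rewrite cmodE.
by rewrite rmorph_sum.
Qed.

Lemma cvg_cpart (I : Type) (F : set_system I) {FF : Filter F} (f : I -> R[i]^o)
    (l : R[i]^o) b :
  f @ F --> l -> (fun i => cpart b (f i)) @ F --> cpart b l.
Proof.
move=> /cvgrPdist_lt fl; apply/cvgrPdist_lt => e e0.
have e0' : 0 < e%:C by rewrite ltcR.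
have := fl _ e0'; apply: filterS => i.
rewrite -cmodE ltcR; apply: le_lt_trans.
by rewrite -cpartB; exact: le_cpart_cmod.
Qed.

Lemma cpart_cvg (I : Type) (F : set_system I) {FF : Filter F} (f : I -> R[i]^o)
    (l : R[i]^o) :
  (forall b, (fun i => cpart b (f i)) @ F --> cpart b l) -> f @ F --> l.
Proof.
move=> fl; apply/cvgrPdist_lt => e.
rewrite ltcE /= => /andP[/eqP e1 e2].
have e20 : 0 < complex.Re e / 2 by rewrite divr_gt0.
have [h1 h2] : (\forall i \near F, `|cpart true l - cpart true (f i)| < complex.Re e / 2) /\
    (\forall i \near F, `|cpart false l - cpart false (f i)| < complex.Re e / 2).
  by split; [move/cvgrPdist_lt: (fl true)|move/cvgrPdist_lt: (fl false)]; exact.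
apply: filterS2 h1 h2 => i h1 h2.
have -> : e = (complex.Re e)%:C by case: e e1 {e2 e20 h1 h2} => a c /= ->.
rewrite -cmodE ltcR (le_lt_trans (cmod_le_cpart _))// !cpartB.
by rewrite [ltRHS](splitr (complex.Re e)) ltrD.
Qed.

End complex_components.

Section pairing_convergence.
Context {R : realType} {d : nat}.
Implicit Types (Pi : nat -> set (seq 'I_d)) (u : tensor_series R[i] d)
  (x : tensor_series R d).

(** A block contains words of one length only, hence it is finite and its sum is a
genuine sum over the tuples of that length. *)
Lemma block_sum_tuple Pi u x k n : homogeneous_partition Pi ->
  (exists2 I, Pi k I & size I = n) ->
  \sum_(I \in Pi k) u I * (x I)%:C
    = \sum_(I : n.-tuple 'I_d | tval I \in Pi k) u I * (x I)%:C.
Proof.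
move=> [_ hom] [I0 PI0 sI0].
pose r := map (@tval n 'I_d) (enum {: n.-tuple 'I_d}).
have ur : uniq r by rewrite map_inj_uniq ?enum_uniq//; exact: val_inj.
rewrite -[in LHS](set_mem_set (Pi k)) -(@bigfs _ _ _ _ r); last first.
- move=> I; rewrite inE => PI; have sI : size I == n by rewrite (hom k I I0)// sI0.
  by move=> /mapP; case; exists (Tuple sI); rewrite ?mem_enum.
- exact: ur.
by rewrite big_map big_enum_cond.
Qed.

End pairing_convergence.

Section levels.
Context {R : realType} {d : nat}.
Variables (Pi : nat -> set (seq 'I_d)).
Hypothesis hPi : homogeneous_partition Pi.
Implicit Types (u : tensor_series R[i] d) (x : tensor_series R d).

Let block_level k n u x : R[i] :=
  \sum_(I : n.-tuple 'I_d | tval I \in Pi k) u I * (x I)%:C.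

Let sum_block_level k u x N :
  \sum_(n < N) cmod (block_level k n u x)
    <= cmod (\sum_(I \in Pi k) u I * (x I)%:C).
Proof.
have [[_ _ /(_ k I) [I0 PI0]] hom] := hPi.
have B0 n : n != size I0 -> block_level k n u x = 0.
  move=> nI0; rewrite /block_level big_pred0// => I; apply/negP; rewrite inE => PI.
  by move/eqP: nI0; apply; rewrite -(size_tuple I); exact: (hom k).
have [sN|Ns] := ltnP (size I0) N; last first.
  rewrite big1 ?cmod_ge0// => n _; rewrite B0 ?cmod0//.
  by rewrite neq_ltn (leq_trans (ltn_ord n) Ns).
rewrite (bigD1 (Ordinal sN))//= big1 ?addr0; last first.
  by move=> n /eqP nI; rewrite B0 ?cmod0//; apply/eqP => nE; apply: nI; apply: val_inj.
by rewrite (@block_sum_tuple R d Pi u x k (size I0) hPi)//; exists I0.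
Qed.

Let level_blocks n u x K :
  (forall I : n.-tuple 'I_d, exists2 k, (k < K)%N & Pi k I) ->
  level_pairing n u x = \sum_(k < K) block_level k n u x.
Proof.
have [[_ triv _] _] := hPi.
move=> cov; rewrite /level_pairing.
under [RHS]eq_bigr do rewrite /block_level big_mkcond.
rewrite exchange_big/=; apply: eq_bigr => I _.
have [k kK Pk] := cov I.
rewrite (bigD1 (Ordinal kK))//= mem_set// big1 ?addr0// => j /eqP jk.
case: ifPn => //; rewrite inE => Pj; exfalso; apply: jk; apply: val_inj => /=.
by apply: triv => //; exists (tval I).
Qed.

(** Finitely many blocks cover the words shorter than N, and a level is the sum of the
blocks it contains; by the triangle inequality each block is counted at most once. *)
Lemma sum_cmod_level_le u x N :
  ((\sum_(n < N) cmod (level_pairing n u x))%:E <= block_norm Pi x u)%E.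
Proof.
have [[cov _ _] _] := hPi.
have exk (I : seq 'I_d) : exists k, Pi k I.
  by have : setT I by []; rewrite -cov => -[k _ PI]; exists k.
have [kf Pkf] := choice exk.
pose K := \max_(n < N) \max_(I : n.-tuple 'I_d) (kf I).+1.
have covK n : (n < N)%N -> forall I : n.-tuple 'I_d, exists2 k, (k < K)%N & Pi k I.
  move=> nN I; exists (kf I); last exact: Pkf.
  apply: (@leq_trans (\max_(J : n.-tuple 'I_d) (kf J).+1)).
    exact: (@leq_bigmax _ (fun J : n.-tuple 'I_d => (kf J).+1) I).
  exact: (@leq_bigmax _ (fun m : 'I_N => \max_(J : m.-tuple 'I_d) (kf J).+1) (Ordinal nN)).
apply: (@le_trans _ _ (\sum_(k < K) cmod (\sum_(I \in Pi k) u I * (x I)%:C))%:E).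
  rewrite lee_fin; apply: (@le_trans _ _ (\sum_(n < N) \sum_(k < K) cmod (block_level k n u x))).
    apply: ler_sum => n _; rewrite (level_blocks n u x K (covK n (ltn_ord n))).
    exact: cmod_sum.
  by rewrite exchange_big/=; apply: ler_sum => k _; exact: sum_block_level.
rewrite -sumEFin /block_norm.
rewrite -(big_mkord xpredT (fun k => (cmod (\sum_(I \in Pi k) u I * (x I)%:C))%:E)).
by apply: nneseries_lim_ge => k _ _; rewrite lee_fin cmod_ge0.
Qed.

Definition level_partial N u x : R[i] := \sum_(n < N.+1) level_pairing n u x.

Lemma sum_cpart_level_le b u x N :
  ((\sum_(n < N) `|cpart b (level_pairing n u x)|)%:E <= block_norm Pi x u)%E.
Proof.
apply: le_trans (sum_cmod_level_le u x N); rewrite lee_fin.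
by apply: ler_sum => n _; exact: le_cpart_cmod.
Qed.

(** The block norm bounds the partial sums of the absolute values of the levels, so the
series over levels converges absolutely. *)
Lemma cvg_level_partial u x b : (block_norm Pi x u < +oo)%E ->
  cpart b (level_partial N u x) @[N --> \oo] --> cpart b (pairing u x).
Proof.
move=> bfin.
have part_cvg b' : cvgn (fun N => cpart b' (level_partial N u x)).
  have : cvgn (series (fun n => cpart b' (level_pairing n u x))).
    apply: normed_cvg; apply: nondecreasing_is_cvgn.
      by apply: nondecreasing_series => n _ _; exact: normr_ge0.
    exists (fine (block_norm Pi x u)) => _ [N _ <-] /=.
    rewrite -lee_fin fineK.
      rewrite /series/= big_mkord; exact: sum_cpart_level_le.
    rewrite ge0_fin_numE//; apply: nneseries_ge0 => k _ _.
    by rewrite lee_fin cmod_ge0.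
  rewrite -cvg_shiftS => /cvgP.
  suff -> : (fun N => cpart b' (level_partial N u x)) = fun N => series
    (fun n => cpart b' (level_pairing n u x)) N.+1 by [].
  by apply: funext => N; rewrite /series/= big_mkord /level_partial cpart_sum.
have : (fun N => level_partial N u x : R[i]^o) @ \oo -->
    ((limn (fun N => cpart true (level_partial N u x)))
      +i* (limn (fun N => cpart false (level_partial N u x))) : R[i]^o).
  by apply: cpart_cvg => -[]; exact: part_cvg.
move=> cv; rewrite /pairing (cvg_lim _ cv)//.
exact: cvg_cpart.
Qed.

End levels.

Section lower_integral.
Context {R : realType} {d} {Z : measurableType d}.
Local Open Scope ereal_scope.

(** The integral of a nonnegative function is a supremum over the simple functions
below it, hence monotone without any measurability. *)
Lemma le_integral_ge0 (m : {measure set Z -> \bar R}) (D : set Z)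
    (f1 f2 : Z -> \bar R) :
  (forall z, D z -> 0 <= f1 z) -> (forall z, D z -> f1 z <= f2 z) ->
  \int[m]_(z in D) f1 z <= \int[m]_(z in D) f2 z.
Proof.
move=> f10 f12; rewrite integral_mkcond [leRHS]integral_mkcond.
have p10 z : 0 <= (f1 \_ D) z.
  by rewrite patchE; case: ifPn => //; rewrite inE => /f10.
have p12 z : (f1 \_ D) z <= (f2 \_ D) z.
  by rewrite !patchE; case: ifPn => //; rewrite inE => /f12.
rewrite !ge0_integralTE//; last by move=> z; exact: le_trans (p12 z).
apply: le_ereal_sup => _ [h hf <-]; exists h => // z /=.
exact: le_trans (hf z) (p12 z).
Qed.

End lower_integral.

Section primitive_limits.
Context {R : realType}.
Notation mu := (@lebesgue_measure R).

Lemma primitive_of_cst T (c : R) : primitive_of T (fun=> 0) (fun=> c).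
Proof.
split; first exact: integrable0.
by move=> t _; rewrite Rintegral_cst// mul0r addr0.
Qed.

Lemma primitive_of_sum T (I : Type) (r : seq I) (q p : I -> R -> R) :
  (forall i, primitive_of T (q i) (p i)) ->
  primitive_of T (fun s => \sum_(i <- r) q i s) (fun s => \sum_(i <- r) p i s).
Proof.
move=> qp; elim: r => [|i r IH].
  by apply: eq_primitive_of (primitive_of_cst T 0) => s _; rewrite big_nil.
by apply: eq_primitive_of (primitive_ofD _ _ _ _ _ (qp i) IH) => s _;
  rewrite big_cons.
Qed.

Lemma primitive_of_lim T (q_ p_ : nat -> R -> R) (q p : R -> R) (G : R -> \bar R) :
  0 <= T ->
  (forall n, primitive_of T (q_ n) (p_ n)) ->
  (forall s, 0 <= s <= T -> q_ n s @[n --> \oo] --> q s) ->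
  (forall s, 0 <= s <= T -> p_ n s @[n --> \oo] --> p s) ->
  mu.-integrable `[0, T] G ->
  (forall n s, 0 <= s <= T -> (`|(q_ n s)%:E| <= G s)%E) ->
  primitive_of T q p.
Proof.
move=> T0 qp qq pp iG qG.
have mq_ n : measurable_fun `[0, T] (q_ n).
  by have [/measurable_int/measurable_EFinP] := qp n.
have mq : measurable_fun `[0, T] q.
  by apply: (measurable_fun_cvg mq_) => s; exact: qq.
split.
  apply: (le_integrable _ _ _ iG) => //; first exact/measurable_EFinP.
  move=> s sT; apply: le_trans (lee_abs _).
  have : (fun n => `|(q_ n s)%:E|)%E @ \oo --> `|(q s)%:E|%E.
    by apply: cvg_abse; apply: cvg_EFin; [exact: nearW|exact: qq].
  move=> /cvg_lim <-//; apply: lime_le.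
    apply: is_cvg_abse; apply/cvg_ex; exists (q s)%:E.
    by apply: cvg_EFin; [exact: nearW|exact: qq].
  by apply: nearW => n; exact: qG.
move=> t tT; case/andP: (tT) => t0 tT'.
have sub : `[0, t]%classic `<=` `[0, T]%classic by apply: subset_itvScc.
have lhs : p_ n t @[n --> \oo] --> p t by exact: pp.
have rhs : p_ n 0 + \int[mu]_(x in `[0, t]) q_ n x @[n --> \oo]
    --> p 0 + \int[mu]_(x in `[0, t]) q x.
  apply: cvgD; first by apply: pp; rewrite lexx.
  apply: (@cvg_Rintegral_dominated _ _ (measurableTypeR R) mu _ _ _ G) => //.
  - by move=> n; exact: measurable_funS (mq_ n).
  - exact: measurable_funS mq.
  - by apply: aeW => s st; apply: qq; exact: (sub s st).
  - exact: integrableS iG.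
  - by apply: aeW => s n st; apply: qG; exact: (sub s st).
apply: (cvg_unique _ lhs); first exact: norm_hausdorff.
apply: cvg_trans rhs; apply: near_eq_cvg; apply: nearW => n.
by have [_ /(_ t tT)] := qp n.
Qed.

End primitive_limits.

Section riccati.
Context {R : realType} {d : nat}.
Notation mu := (@lebesgue_measure R).
Variables (Pi : nat -> set (seq 'I_d)).
Hypothesis hPi : homogeneous_partition Pi.

Lemma cpart_cintegral {disp} {Z : measurableType disp}
    (m : {measure set Z -> \bar R}) (D : set Z) (f : Z -> R[i]) b :
  cpart b (cintegral m D f) = \int[m]_(z in D) cpart b (f z).
Proof. by case: b. Qed.

Lemma cpart_level_partial N (v : tensor_series R[i] d) (x : tensor_series R d) b :
  cpart b (level_partial N v x)
    = \sum_(n < N.+1) \sum_(I : n.-tuple 'I_d) cpart b (v I) * x I.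
Proof.
rewrite /level_partial cpart_sum; apply: eq_bigr => n _.
by rewrite /level_pairing cpart_sum; apply: eq_bigr => I _; rewrite cpartMr.
Qed.

(** The Riccati equation makes every coordinate of psi absolutely continuous, hence also
the finite sums over the levels up to N.  The limit N -> oo is taken by dominated
convergence; the majorant of the densities is the sum G of the absolute values of the
levels, which is measurable and lies below the block norm. *)
Lemma primitive_pairing (T : R) (u : tensor_series R[i] d)
    (psi a : R -> tensor_series R[i] d) (x : tensor_series R d) b :
  0 <= T ->
  (forall I, cintegrable mu `[0, T] (fun s => a s I)) ->
  (forall I t, 0 <= t <= T ->
     psi t I = u I + cintegral mu `[0, t] (fun s => a s I)) ->
  (forall t, 0 <= t <= T -> (block_norm Pi x (psi t) < +oo)%E) ->
  (forall t, 0 <= t <= T -> (block_norm Pi x (a t) < +oo)%E) ->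
  (\int[mu]_(s in `[0%R, T]) block_norm Pi x (a s) < +oo)%E ->
  primitive_of T (fun s => cpart b (pairing (a s) x))
    (fun s => cpart b (pairing (psi s) x)).
Proof.
move=> T0 ia psiE psifin afin intfin.
have coord I : primitive_of T (fun s => cpart b (a s I)) (fun s => cpart b (psi s I)).
  split; first by case: (ia I); case: b.
  have psi0 : psi 0 I = u I.
    rewrite psiE ?lexx//; apply: cpart_inj => b'.
    by rewrite cpartD cpart_cintegral set_itv1 Rintegral_set1 addr0.
  by move=> t tT; rewrite psi0 psiE// cpartD cpart_cintegral.
have partial N : primitive_of T (fun s => cpart b (level_partial N (a s) x))
    (fun s => cpart b (level_partial N (psi s) x)).
  apply: (eq_primitive_of _ _ _ _ _ _ _ (primitive_of_sum T _ _
    (fun (n : 'I_N.+1) s => \sum_(I : n.-tuple 'I_d) cpart b (a s I) * x I)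
    (fun n s => \sum_(I : n.-tuple 'I_d) cpart b (psi s I) * x I) _)).
  - by move=> s _; rewrite cpart_level_partial.
  - by move=> s _; rewrite cpart_level_partial.
  move=> n; apply: primitive_of_sum => I.
  by apply: eq_primitive_of (primitive_ofZ _ _ _ (x I) (coord I)) => s _;
    rewrite mulrC.
pose G s : \bar R := (\sum_(0 <= n <oo) `|cpart b (level_pairing n (a s) x)|%:E)%E.
have GN s N : ((\sum_(n < N) `|cpart b (level_pairing n (a s) x)|)%:E <= G s)%E.
  rewrite -sumEFin -(big_mkord xpredT (fun n => (`|cpart b (level_pairing n (a s) x)|)%:E)).
  by apply: nneseries_lim_ge => n _ _; rewrite lee_fin.
have G0 s : (0 <= G s)%E by apply: nneseries_ge0 => n _ _; rewrite lee_fin.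
have GB s : (G s <= block_norm Pi x (a s))%E.
  apply: lime_le.
    by apply: is_cvg_nneseries => n _ _; rewrite lee_fin.
  apply: nearW => N; rewrite sumEFin big_mkord.
  exact: sum_cpart_level_le.
have mlev n : measurable_fun `[0, T]
    (fun s : measurableTypeR R => cpart b (level_pairing n (a s) x)).
  rewrite (_ : (fun s => _) = fun s => \sum_(I : n.-tuple 'I_d) cpart b (a s I) * x I).
    apply: measurable_sum => I; apply: measurable_funM => //.
    by case: (coord I) => /measurable_int/measurable_EFinP.
  apply: funext => s; rewrite /level_pairing cpart_sum.
  by apply: eq_bigr => I _; rewrite cpartMr.
have iG : mu.-integrable `[0, T] G.
  apply/integrableP; split.
    apply: ge0_emeasurable_sum => [n s _ _|n _]; first by rewrite lee_fin.
    by apply/measurable_EFinP; apply: measurableT_comp => //; exact: mlev.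
  under eq_integral do rewrite gee0_abs//.
  by apply: le_lt_trans intfin; apply: le_integral_ge0 => // s _.
apply: (@primitive_of_lim _ T _ _ _ _ G T0 partial) => //.
- by move=> s sT; apply: (cvg_level_partial _ hPi); exact: afin.
- by move=> s sT; apply: (cvg_level_partial _ hPi); exact: psifin.
- move=> N s _; apply: le_trans (GN s N.+1); rewrite lee_fin.
  by rewrite /level_partial cpart_sum ler_norm_sum.
Qed.

End riccati.

Section complex_exponential.
Context {R : realType}.

Lemma primitive_cexp (T : R) (q z : R -> R[i]) : 0 <= T ->
  (forall b, primitive_of T (cpart b \o q) (cpart b \o z)) ->
  forall b, primitive_of T (fun s => cpart b (cexp (z s) * q s))
    (fun s => cpart b (cexp (z s))).
Proof.
move=> T0 qz.
have pexp := primitive_of_comp _ _ _ _ _ T0 (qz true)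
  (fun x => is_derive_expR x) (@continuous_expR R).
have pcos := primitive_of_comp _ _ _ _ _ T0 (qz false)
  (fun x => is_derive_cos x) (fun x => continuousN (@continuous_sin R x)).
have psin := primitive_of_comp _ _ _ _ _ T0 (qz false)
  (fun x => is_derive_sin x) (@continuous_cos R).
case.
  apply: eq_primitive_of (primitive_ofM _ _ _ _ _ T0 pexp pcos) => s _ //=.
  by rewrite /cexp; case: (z s) (q s) => [z1 z2] [q1 q2] /=; ring.
apply: eq_primitive_of (primitive_ofM _ _ _ _ _ T0 pexp psin) => s _ //=.
by rewrite /cexp; case: (z s) (q s) => [z1 z2] [q1 q2] /=; ring.
Qed.

End complex_exponential.

(** * Processes with right-continuous versions *)

Section clamp.
Context {R : realType}.
Variable T : R.
Hypothesis T0 : 0 < T.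

(** Projection of the time axis onto [0, T].  Composing with it turns functions that are
meaningful on [0, T] only into functions of all times without losing measurability or
right continuity. *)
Definition clamp (t : R) : R := Num.max 0 (Num.min t T).

Lemma clamp_itv t : 0 <= clamp t <= T.
Proof. by rewrite /clamp le_max lexx ge_max (ltW T0) ge_min lexx orbT. Qed.

Lemma clamp_id t : 0 <= t <= T -> clamp t = t.
Proof. by case/andP => t0 tT; rewrite /clamp min_l// max_r. Qed.

Lemma measurable_clamp : measurable_fun setT clamp.
Proof. by apply: measurable_maxr => //; exact: measurable_minr. Qed.

Lemma measurable_comp_clamp (f : R -> R) : measurable_fun `[0, T] f ->
  measurable_fun setT (f \o clamp).
Proof.
move=> mf; apply: (measurable_comp (F := `[0, T]%classic)) => //.
- by move=> _ [t _ <-]; rewrite /= in_itv/= clamp_itv.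
- exact: measurable_clamp.
Qed.

Lemma le_clamp t u : t <= u -> clamp t <= clamp u.
Proof.
move=> tu; rewrite /clamp ge_max le_max lexx/= le_max; apply/orP; right.
by rewrite le_min !ge_min tu lexx orbT.
Qed.

Lemma clamp_le_add t u : t <= u -> clamp u <= clamp t + (u - t).
Proof.
move=> tu; have /andP[c0 cT] := clamp_itv t.
rewrite [leLHS]/clamp ge_max addr_ge0 ?subr_ge0//=.
have mc : Num.min t T <= clamp t by rewrite /clamp le_max lexx orbT.
have [tT|Tt] := leP t T.
  by rewrite ge_min; apply/orP; left; rewrite min_l// in mc; lra.
rewrite ge_min; apply/orP; right; rewrite min_r ?(ltW Tt)// in mc.
by lra.
Qed.

(** The projection is nondecreasing and 1-Lipschitz, so it preserves convergence from
the right; from T on it is constant, and the path is not evaluated beyond T. *)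
Lemma cadlag_right_continuous (g : R -> R[i]^o) b : cadlag T g ->
  right_continuous (fun t => cpart b (g (clamp t))).
Proof.
move=> [rc _] t u tu ut; rewrite /comp.
have [Tt|tT] := leP T t.
  have cT v : t <= v -> clamp v = T.
    by move=> tv; rewrite /clamp min_r ?max_r ?(ltW T0)// (le_trans Tt).
  rewrite cT//; apply: cvg_trans (@cvg_cst _ (cpart b (g T)) _ \oo _).
  by apply: near_eq_cvg; apply: nearW => n; rewrite cT.
have cT : 0 <= clamp t < T.
  by case/andP: (clamp_itv t) => -> _; rewrite /= /clamp min_l ?(ltW tT)// gt_max T0 tT.
have /cvgrPdist_lt rcg : cpart b (g y) @[y --> (clamp t)^'+] --> cpart b (g (clamp t)).
  by apply: cvg_cpart; exact: rc.
apply/cvgrPdist_lt => e e0.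
have [/= d d0 hd] := rcg e e0.
move/cvgrPdist_lt : ut => /(_ d d0); apply: filterS => n utn.
have := le_clamp _ _ (tu n); rewrite le_eqVlt => /predU1P[<-|ctu].
  by rewrite subrr normr0.
apply: hd => //=.
have := clamp_le_add _ _ (tu n).
rewrite ltr0_norm ?subr_lt0//; rewrite ler0_norm ?subr_le0// in utn.
by lra.
Qed.

End clamp.

Section measurability.
Context {R : realType} {disp : measure_display} {Z : measurableType disp}.

Lemma measurable_coordinate {d : nat} {S : set (tensor_series R d)} (T : R)
    (X : R -> Z -> S) t (I : seq 'I_d) :
  tensor_process T X -> 0 <= t <= T ->
  measurable_fun setT (fun w => val (X t w) I).
Proof.
move=> tX tT _ B mB; rewrite setTI.
apply: (tX t tT [set a | B (a I)]); apply: sub_sigma_algebra.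
by exists I, B.
Qed.

Lemma measurable_pairing {d : nat} (Pi : nat -> set (seq 'I_d))
    (v : Z -> tensor_series R[i] d) (y : Z -> tensor_series R d) :
  homogeneous_partition Pi ->
  (forall I b, measurable_fun setT (fun z => cpart b (v z I))) ->
  (forall I, measurable_fun setT (fun z => y z I)) ->
  (forall z, (block_norm Pi (y z) (v z) < +oo)%E) ->
  forall b, measurable_fun setT (fun z => cpart b (pairing (v z) (y z))).
Proof.
move=> hPi mv my bfin b.
apply: (@measurable_fun_cvg _ _ _ _
  (fun N z => cpart b (level_partial N (v z) (y z)))); last first.
  by move=> z _; apply: (cvg_level_partial _ hPi); exact: bfin.
move=> N; rewrite (_ : (fun z => _) = fun z =>
    \sum_(n < N.+1) \sum_(I : n.-tuple 'I_d) cpart b (v z I) * y z I).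
  apply: measurable_sum => n; apply: measurable_sum => I.
  exact: measurable_funM.
by apply: funext => z; rewrite cpart_level_partial.
Qed.

Lemma measurable_cexp (z : Z -> R[i]) :
  (forall b, measurable_fun setT (fun w => cpart b (z w))) ->
  forall b, measurable_fun setT (fun w => cpart b (cexp (z w))).
Proof.
move=> mz; have mexp : measurable_fun setT (fun w => expR (complex.Re (z w))).
  by apply: measurableT_comp; [exact: measurable_expR|exact: (mz true)].
have mcos : measurable_fun setT (fun w => cos (complex.Im (z w))).
  apply: measurableT_comp; last exact: (mz false).
  exact: continuous_measurable_fun (@continuous_cos R).
have msin : measurable_fun setT (fun w => sin (complex.Im (z w))).
  apply: measurableT_comp; last exact: (mz false).
  exact: continuous_measurable_fun (@continuous_sin R).
by case; exact: measurable_funM.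
Qed.

Lemma measurable_mulC (z1 z2 : Z -> R[i]) :
  (forall b, measurable_fun setT (fun w => cpart b (z1 w))) ->
  (forall b, measurable_fun setT (fun w => cpart b (z2 w))) ->
  forall b, measurable_fun setT (fun w => cpart b (z1 w * z2 w)).
Proof.
move=> m1 m2; case.
  rewrite (_ : (fun w => _) = fun w => cpart true (z1 w) * cpart true (z2 w)
      - cpart false (z1 w) * cpart false (z2 w)).
    by apply: measurable_funB; exact: measurable_funM.
  by apply: funext => w; case: (z1 w) (z2 w) => [? ?] [? ?].
rewrite (_ : (fun w => _) = fun w => cpart true (z1 w) * cpart false (z2 w)
    + cpart false (z1 w) * cpart true (z2 w)).
  by apply: measurable_funD; exact: measurable_funM.
by apply: funext => w; case: (z1 w) (z2 w) => [? ?] [? ?].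
Qed.

Lemma ae_eq_Rintegral (m : {measure set Z -> \bar R}) (f g : Z -> R) :
  measurable_fun setT f -> measurable_fun setT g ->
  {ae m, forall z, f z = g z} -> \int[m]_z f z = \int[m]_z g z.
Proof.
move=> mf mg fg; rewrite /Rintegral; congr fine; apply: ae_eq_integral => //.
- exact/measurable_EFinP.
- exact/measurable_EFinP.
- by apply: filterS fg => z -> _.
Qed.

End measurability.

Section versions.
Context {R : realType} {disp : measure_display} {Omega : measurableType disp}.
Variables (P : probability Omega R) (g gX : R -> Omega -> R) (Zsup : Omega -> \bar R).
Hypothesis mg : forall t, measurable_fun setT (g t).
Hypothesis mgX : forall t, measurable_fun setT (gX t).
Hypothesis ggX : forall t, {ae P, forall w, g t w = gX t w}.
Hypothesis rcg : forall w, right_continuous (g^~ w).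
Hypothesis gXZ : forall t w, (`|(gX t w)%:E| <= Zsup w)%E.
Hypothesis Zfin : (\int[P]_w Zsup w < +oo)%E.

Lemma version_abs_moment t :
  (\int[P]_w `|(g t w)%:E| <= \int[P]_w Zsup w)%E.
Proof.
have -> : (\int[P]_w `|(g t w)%:E| = \int[P]_w `|(gX t w)%:E|)%E.
  apply: ge0_ae_eq_integral => //.
  - by apply: measurableT_comp => //; exact/measurable_EFinP.
  - by apply: measurableT_comp => //; exact/measurable_EFinP.
  - by apply: filterS (ggX t) => w -> _.
by apply: le_integral_ge0.
Qed.

Let q (n : nat) : R := ratr (odflt 0 (unpickle n)).

(** The majorant is the supremum of |g| over rational times: right continuity extends the
bound to all times, and almost surely this countable supremum is the one of gX, which
lies below Zsup. *)
Lemma version_dominated : exists G : Omega -> \bar R,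
  P.-integrable setT G /\ forall t w, (`|(g t w)%:E| <= G w)%E.
Proof.
pose G (h : R -> Omega -> R) w := esups (fun n => `|(h (q n) w)%:E|%E) 0%N.
have Gub h n w : (`|(h (q n) w)%:E| <= G h w)%E.
  by apply: ereal_sup_ubound; exists n.
have G0 h w : (0 <= G h w)%E by apply: le_trans (Gub h 0%N w).
have mG h : (forall t, measurable_fun setT (h t)) -> measurable_fun setT (G h).
  move=> mh; apply: measurable_fun_esups => n.
  by apply: measurableT_comp => //; exact/measurable_EFinP.
exists (G g); split.
  apply/integrableP; split; first exact: mG.
  under eq_integral do rewrite gee0_abs//.
  have -> : (\int[P]_w G g w = \int[P]_w G gX w)%E.
    apply: ge0_ae_eq_integral => //; [exact: mG|exact: mG|].
    have : {ae P, forall w n, g (q n) w = gX (q n) w}.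
      by apply/ae_foralln => n; exact: ggX.
    apply: filterS => w hw _; rewrite /G; congr esups.
    by apply: funext => n; rewrite hw.
  apply: le_lt_trans Zfin; apply: le_integral_ge0 => // w _.
  by apply: ge_ereal_sup => _ [n _ <-].
move=> t w.
have /choice[k hk] : forall n : nat, exists j, t < q j < t + n.+1%:R^-1.
  move=> n.
  have [r] : exists r, ratr r \in `]t, (t + n.+1%:R^-1)[.
    by apply: rat_in_itvoo; rewrite ltrDl invr_gt0 ltr0n.
  rewrite in_itv/= => hr; exists (pickle r).
  by rewrite /q pickleK.
have cq : (q \o k) @ \oo --> t.
  apply: (@squeeze_cvgr _ _ _ _ (fun=> t) (fun n => t + n.+1%:R^-1)).
  - by apply: nearW => n; have /andP[h1 h2] := hk n; rewrite !ltW.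
  - exact: cvg_cst.
  - rewrite -[X in _ --> X]addr0; apply: cvgD; first exact: cvg_cst.
    exact: cvg_harmonic.
have : (fun n => `|(g (q (k n)) w)%:E|%E) @ \oo --> `|(g t w)%:E|%E.
  apply: cvg_abse; apply: cvg_EFin; first exact: nearW.
  by apply: (rcg w t (q \o k)) => // n; have /andP[/ltW] := hk n.
move=> cg; rewrite -(cvg_lim _ cg)//; apply: lime_le.
  by apply/cvg_ex; eexists; exact: cg.
by apply: nearW => n; exact: Gub.
Qed.

End versions.

(** * The affine transform formula *)

Section localization.
Context {R : realType} {disp : measure_display} {Omega : measurableType disp}.

(** Each stopped process has mean 0 because it starts at 0.  Almost every path is
eventually not stopped before t, and the stopped values are values of M at times in
[0, T], so the majorant of M allows passing to the limit. *)
Lemma local_martingale_mean0 (P : probability Omega R)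
    (F : R -> set (set Omega)) (T : R) (M : R -> Omega -> R[i])
    (G : Omega -> \bar R) b :
  filtration F -> local_martingale P F T M ->
  (forall w, M 0 w = 0) -> P.-integrable setT G ->
  (forall t w, 0 <= t <= T -> (`|(cpart b (M t w))%:E| <= G w)%E) ->
  forall t, 0 <= t <= T -> \int[P]_w cpart b (M t w) = 0.
Proof.
move=> hF [adM [tau [st _ cvtau mart]]] M0 iG MG t tT.
case/andP: (tT) => t0 tT'.
have FT : F 0 setT.
  have [F0 FD _] := filtration_sigma_algebra hF (lexx 0).
  by have := FD _ F0; rewrite setD0.
have stop_itv n w s : 0 <= s <= T -> 0 <= fine (Order.min s%:E (tau n w)) <= T.
  move=> /andP[s0 sT]; have := (st n).1 w; case: (tau n w) => [r| |] //=.
    rewrite lee_fin => r0; rewrite -EFin_min /=.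
    by rewrite le_min s0 r0 ge_min sT.
  by rewrite miney /= s0 sT.
have mean n : \int[P]_w cpart b (stopped M (tau n) t w) = 0.
  have [_ _ /(_ 0 t (lexx 0) t0 tT' setT FT)] := mart n.
  move=> /(congr1 (cpart b)); rewrite !cpart_cintegral => ->.
  rewrite (_ : (fun w => _) = fun=> 0); first by rewrite Rintegral_cst// mul0r.
  apply: funext => w; rewrite /stopped.
  have -> : Order.min 0%:E (tau n w) = 0%:E by rewrite min_l//; exact: (st n).1.
  by rewrite /= M0; case: (b).
have mM : measurable_fun setT (fun w => cpart b (M t w)).
  move=> _ B mB; rewrite setTI; apply: (filtration_measurable hF t0).
  by have [mRe mIm] := adM t tT B mB; case: (b).
have mMn n : measurable_fun setT (fun w => cpart b (stopped M (tau n) t w)).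
  have [_ /(_ t tT) [iRe iIm] _] := mart n.
  by apply/measurable_EFinP; case: (b); [exact: measurable_int iRe|exact: measurable_int iIm].
have lim : \int[P]_w cpart b (stopped M (tau n) t w) @[n --> \oo]
    --> \int[P]_w cpart b (M t w).
  apply: (@cvg_Rintegral_dominated _ _ _ P setT _ _ G) => //.
  - apply: filterS cvtau => w /cvgeyPge/(_ t) ht _.
    apply: cvg_trans (@cvg_cst _ (cpart b (M t w)) _ \oo _).
    apply: near_eq_cvg; apply: filterS ht => n tn.
    by rewrite /stopped min_l.
  - by apply: aeW => w n _; apply: MG; exact: stop_itv.
apply: (cvg_unique _ lim); first exact: norm_hausdorff.
rewrite (_ : (fun n => _) = fun=> 0); last by apply: funext => n; rewrite mean.
exact: cvg_cst.
Qed.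

End localization.

Section integral_bound.
Context {R : realType}.
Notation mu := (@lebesgue_measure R).

Lemma abs_Rintegral_itv_le (k : R -> R) (g : \bar R) (t T : R) :
  measurable_fun setT k -> 0 <= t -> t <= T ->
  (forall r, (`|(k r)%:E| <= g)%E) ->
  (`|(\int[mu]_(r in `[0, t]) k r)%:E| <= T%:E * g)%E.
Proof.
move=> mk t0 tT kg.
have g0 : (0 <= g)%E by apply: le_trans (kg 0).
have mEk : measurable_fun (`[0, t]%classic : set (measurableTypeR R)) (EFin \o k).
  by apply/measurable_EFinP; exact: measurable_funTS.
have fine_le (y : \bar R) : (`|(fine y)%:E| <= `|y|)%E.
  by case: y => [r| |] //=; rewrite normr0 leey.
apply: (le_trans (fine_le _)).
apply: (le_trans (le_abse_integral mu _ mEk)) => //.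
apply: (@le_trans _ _ (\int[mu]_(r in `[0%R, t]) g)%E).
  by apply: le_integral_ge0 => r _; [exact: abse_ge0|exact: kg].
rewrite integral_cst//= lebesgue_measure_itv/= lte_fin muleC.
apply: lee_wpmul2r => //; case: ifP => _; last by rewrite lee_fin (le_trans t0).
by rewrite sube0 lee_fin.
Qed.

End integral_bound.

Theorem theorem3p5 (R : realType) (disp : measure_display)
    (Omega : measurableType disp) (P : probability Omega R)
    (F : R -> set (set Omega))
    (d : nat) (S : set (tensor_series R d)) (Pi : nat -> set (seq 'I_d))
    (U : set (tensor_series R[i] d)) (L : (S -> R[i]) -> (S -> R[i]))
    (A : tensor_series R[i] d -> tensor_series R[i] d)
    (T : R) (x0 : S) (X : R -> Omega -> S)
    (u : tensor_series R[i] d) (psi : R -> tensor_series R[i] d) :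
  filtration F -> right_continuous_filtration F ->
  homogeneous_partition Pi ->
  U `<=` tensor_dual Pi S ->
  affine_operator Pi U L A ->
  0 < T ->
  solves_martingale_problem P F (exp_span U) L T x0 X ->
  U u ->
  riccati_solution U A T u psi ->
  (forall x : S,
     (\int[lebesgue_measure]_(s in `[0%R, T]) block_norm Pi (val x) (A (psi s))
        < +oo)%E) ->
  (\int[P]_w ereal_sup
     [set (cmod (cexp (pairing (psi s) (val (X t w)))))%:E
        | s in `[0%R, T] & t in `[0%R, T]] < +oo)%E ->
  (\int[P]_w ereal_sup
     [set (cmod (pairing (A (psi s)) (val (X t w))
                 * cexp (pairing (psi s) (val (X t w))))%R)%:E
        | s in `[0%R, T] & t in `[0%R, T]] < +oo)%E ->
  cintegral P setT (fun w => cexp (pairing u (val (X T w))))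
    = cexp (pairing (psi T) (val x0)).
Proof.
move=> hF _ hPi Udual [_ Adual LA] T0 [tX X0 [Y [tY XY Dadapt Dmart]]] _
  [psiU iA psiE] intA mom1 mom2.
have T00 : (0 : R) <= 0 <= T by apply/andP; split=> //; exact: ltW.
have TT : 0 <= T <= T by rewrite (ltW T0) /=.
pose cl := clamp T.
have clT t : 0 <= cl t <= T by exact: clamp_itv.
have psifin s (x : S) : (block_norm Pi (val x) (psi (cl s)) < +oo)%E.
  by apply: (Udual _ (psiU _ (clT s))); case: x => x /= /set_mem.
have Afin s (x : S) : (block_norm Pi (val x) (A (psi (cl s))) < +oo)%E.
  by apply: (Adual _ (psiU _ (clT s))); case: x => x /= /set_mem.
(* [ob] is the real or imaginary part of exp<psi(s),.>, and [im] that of its image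
   under the operator. *)
pose ob b s (x : S) := cpart b (cexp (pairing (psi (cl s)) (val x))).
pose im b s (x : S) := cpart b (cexp (pairing (psi (cl s)) (val x))
  * pairing (A (psi (cl s))) (val x)).
pose e b s t w := ob b s (Y (cl t) w).
pose H b s t w := im b s (Y (cl t) w).
have chain b (x : S) : primitive_of T
    (fun s => cpart b (cexp (pairing (psi s) (val x)) * pairing (A (psi s)) (val x)))
    (fun s => cpart b (cexp (pairing (psi s) (val x)))).
  apply: (@primitive_cexp _ T (fun s => pairing (A (psi s)) (val x))
    (fun s => pairing (psi s) (val x)) (ltW T0)) => b'.
  apply: (@primitive_pairing _ _ _ hPi T u psi (fun s => A (psi s))) => //.
  - exact: ltW.
  - by move=> t tT; have := psifin t x; rewrite /cl clamp_id.
  - by move=> t tT; have := Afin t x; rewrite /cl clamp_id.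
have mpsi I b : measurable_fun setT (fun s : measurableTypeR R => cpart b (psi (cl s) I)).
  apply: (@measurable_comp_clamp _ T T0 (fun s => cpart b (psi s I))).
  apply: measurable_realfun.subspace_continuous_measurable_fun => //.
  apply: (@primitive_of_continuous _ T (fun s => cpart b (A (psi s) I))).
    exact: ltW.
  split; first by case: (iA I); case: b.
  move=> t tT; rewrite psiE// (psiE I 0)// cpartD cpart_cintegral.
  by rewrite cpartD cpart_cintegral set_itv1 Rintegral_set1 addr0.
have mA I b : measurable_fun setT (fun s : measurableTypeR R => cpart b (A (psi (cl s)) I)).
  apply: (@measurable_comp_clamp _ T T0 (fun s => cpart b (A (psi s) I))).
  have [/measurable_int/measurable_EFinP mRe /measurable_int/measurable_EFinP mIm] := iA I.
  by case: b.
have mob (Z : R -> Omega -> S) : tensor_process T Z -> forall b s t,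
    measurable_fun setT (fun w => ob b s (Z (cl t) w)).
  move=> tZ b s t; apply: measurable_cexp => b'.
  apply: (measurable_pairing _ _ _ hPi) => //.
  by move=> I; exact: measurable_coordinate tZ _.
have mim (Z : R -> Omega -> S) : tensor_process T Z -> forall b t,
    measurable_fun setT (fun x : Omega * measurableTypeR R => im b x.2 (Z (cl t) x.1)).
  move=> tZ b t.
  have mcoord I : measurable_fun setT
      (fun x : Omega * measurableTypeR R => val (Z (cl t) x.1) I).
    apply: (measurableT_comp (measurable_coordinate T Z (cl t) I tZ (clT t))).
    exact: measurable_fst.
  apply: measurable_mulC => {}b.
    apply: measurable_cexp => {}b.
    apply: (measurable_pairing _ _ _ hPi) => // I {}b.
    exact: (measurableT_comp (mpsi I b) measurable_snd).
  apply: (measurable_pairing _ _ _ hPi) => // I {}b.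
  exact: (measurableT_comp (mA I b) measurable_snd).
have mimw (Z : R -> Omega -> S) : tensor_process T Z -> forall b s t,
    measurable_fun setT (fun w => im b s (Z (cl t) w)).
  by move=> tZ b s t; exact: (measurable_fun_pair1 (s : measurableTypeR R) (mim Z tZ b t)).
have spanU s : @exp_span R d S U (@exp_pairing R d S (psi (cl s))).
  exists 1%N, (fun=> 1), (fun=> psi (cl s)); split=> [_|]; first exact: psiU.
  by apply: funext => x; rewrite big_ord1 mul1r.
have imE b s x : im b s x = cpart b (L (exp_pairing (psi (cl s))) x).
  by rewrite LA//; exact: psiU.
have rce b s w : right_continuous (fun t => e b s t w).
  have [_ _ /(_ w) cad _] := Dadapt _ (spanU s).
  exact: (@cadlag_right_continuous _ T T0 _ b cad).
have rcH b s w : right_continuous (fun t => H b s t w).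
  have [_ _ _ /(_ w) cad] := Dadapt _ (spanU s).
  rewrite (_ : (fun t => H b s t w) =
    fun t => cpart b (L (exp_pairing (psi (cl s))) (Y (cl t) w))).
    exact: (@cadlag_right_continuous _ T T0 _ b cad).
  by apply: funext => t; rewrite /H imE.
pose Z1 w := ereal_sup [set (cmod (cexp (pairing (psi s) (val (X t w)))))%:E
        | s in `[0%R, T] & t in `[0%R, T]].
pose Z2 w := ereal_sup [set (cmod (pairing (A (psi s)) (val (X t w))
                 * cexp (pairing (psi s) (val (X t w))))%R)%:E
        | s in `[0%R, T] & t in `[0%R, T]].
have obZ b s t w : (`|(ob b s (X (cl t) w))%:E| <= Z1 w)%E.
  apply: (@le_trans _ _ (cmod (cexp (pairing (psi (cl s)) (val (X (cl t) w)))))%:E).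
    by rewrite lee_fin; exact: le_cpart_cmod.
  apply: ereal_sup_ubound; exists (cl s); first by rewrite /= in_itv/= clT.
  by exists (cl t) => //; rewrite /= in_itv/= clT.
have imZ b s t w : (`|(im b s (X (cl t) w))%:E| <= Z2 w)%E.
  apply: (@le_trans _ _ (cmod (pairing (A (psi (cl s))) (val (X (cl t) w))
                 * cexp (pairing (psi (cl s)) (val (X (cl t) w)))))%:E).
    by rewrite /im mulrC lee_fin; exact: le_cpart_cmod.
  apply: ereal_sup_ubound; exists (cl s); first by rewrite /= in_itv/= clT.
  by exists (cl t) => //; rewrite /= in_itv/= clT.
have ver (k : S -> R) t : {ae P, forall w, k (Y (cl t) w) = k (X (cl t) w)}.
  by apply: filterS (XY (cl t) (clT t)) => w ->.
(* Both moment hypotheses are used only through the following majorants, one for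
   each s, and through the bound C, which does not depend on s and t. *)
have dome b s : exists G : Omega -> \bar R,
    P.-integrable setT G /\ forall t w, (`|(e b s t w)%:E| <= G w)%E.
  exact: (version_dominated P (e b s) (fun t w => ob b s (X (cl t) w)) Z1
    (mob Y tY b s) (mob X tX b s) (ver (ob b s)) (rce b s) (obZ b s) mom1).
have domH b s : exists G : Omega -> \bar R,
    P.-integrable setT G /\ forall t w, (`|(H b s t w)%:E| <= G w)%E.
  exact: (version_dominated P (H b s) (fun t w => im b s (X (cl t) w)) Z2
    (mimw Y tY b s) (mimw X tX b s) (ver (im b s)) (rcH b s) (imZ b s) mom2).
have Z20 : (0 <= \int[P]_w Z2 w)%E.
  by apply: integral_ge0 => w _; apply: le_trans (imZ true 0 0 w).
pose C := fine (\int[P]_w Z2 w)%E.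
have CE : C%:E = (\int[P]_w Z2 w)%E by rewrite fineK// ge0_fin_numE.
have HC b s t : (\int[P]_w `|(H b s t w)%:E| <= C%:E)%E.
  rewrite CE.
  exact: (version_abs_moment P (H b s) (fun t w => im b s (X (cl t) w)) Z2
    (mimw Y tY b s) (mimw X tX b s) (ver (im b s)) (imZ b s) t).
have ie b s t : P.-integrable setT (EFin \o e b s t).
  have [G [iG eG]] := dome b s.
  apply: (le_integrable measurableT _ _ iG).
    by apply/measurable_EFinP; exact: (mob Y tY b s t).
  by move=> w _; apply: le_trans (eG t w) (lee_abs _).
have e_first b s t w : 0 <= s <= T ->
    e b s t w - e b 0 t w = \int[lebesgue_measure]_(r in `[0, s]) H b r t w.
  move=> sT; have [_ /(_ s sT)] := chain b (Y (cl t) w).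
  rewrite /e /ob /cl !(clamp_id T s sT) !(clamp_id T 0 T00) => ->.
  rewrite addrAC subrr add0r; apply: eq_Rintegral => r.
  rewrite inE/= in_itv/= => /andP[r0 rs].
  rewrite /H /im /cl (clamp_id T r)// r0 (le_trans rs)//.
  by case/andP: sT.
have mH b t := mim Y tY b t.
have mH2 b s : measurable_fun setT
    (fun x : Omega * measurableTypeR R => H b s x.2 x.1).
  exact: (measurable_fun_right_continuous (H b s) (mimw Y tY b s) (rcH b s)).
have e_second b s t : 0 <= s <= T -> 0 <= t <= T ->
    \int[P]_w (e b s t w - e b s 0 w
      - \int[lebesgue_measure]_(r in `[0, t]) H b s r w) = 0.
  move=> sT tT; have locM := Dmart _ (spanU s).
  set M := (fun t w => _) in locM.
  have ME t' w : 0 <= t' <= T -> cpart b (M t' w) = e b s t' w - e b s 0 w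
      - \int[lebesgue_measure]_(r in `[0, t']) H b s r w.
    move=> t'T; rewrite /M !cpartB cpart_cintegral /e /ob.
    rewrite /cl (clamp_id T t' t'T) (clamp_id T 0 T00) -/cl; congr (_ - _).
    apply: eq_Rintegral => r; rewrite inE/= in_itv/= => /andP[r0 rt].
    rewrite -imE /H /cl clamp_id// r0 (le_trans rt)//.
    by case/andP: t'T.
  have [Ge [iGe eGe]] := dome b s.
  have [GH [iGH HGH]] := domH b s.
  have GH0 w : (0 <= GH w)%E by apply: le_trans (HGH 0 w).
  pose G w := (Ge w + Ge w + T%:E * GH w)%E.
  have iG : P.-integrable setT G.
    apply: integrableD => //; first exact: integrableD.
    exact: integrableZl.
  rewrite -[RHS](local_martingale_mean0 P F T M G b hF locM _ iG _ t tT).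
  - by apply: eq_Rintegral => w _; rewrite ME.
  - by move=> w; rewrite /M subrr set_itv1; apply: cpart_inj => b';
      rewrite cpartB cpart_cintegral Rintegral_set1 subr0.
  move=> t' w t'T; rewrite ME//.
  apply: (@le_trans _ _ (`|(e b s t' w)%:E| + `|(e b s 0 w)%:E|
      + `|(\int[lebesgue_measure]_(r in `[0%R, t']) H b s r w)%:E|)%E).
    rewrite -!EFinD lee_fin; apply: (le_trans (ler_normB _ _)).
    by rewrite lerD2r; exact: ler_normB.
  apply: leeD; first by apply: leeD; exact: eGe.
  case/andP: t'T => t'0 t'T; apply: abs_Rintegral_itv_le => //.
  exact: (measurable_fun_pair2 w (mH2 b s)).
have exch b := @expectation_exchange R _ Omega P (e b) (H b) T C.
apply: cpart_inj => b; rewrite cpart_cintegral.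
have [GH GHP] := choice (domH b).
have := exch b GH T0 (ie b) (mH b) (rcH b) (HC b) (fun s => (GHP s).1)
  (fun s => (GHP s).2) (e_first b) (e_second b).
have psi0 : psi 0 = u.
  apply: funext => I; rewrite psiE//; apply: cpart_inj => b'.
  by rewrite cpartD cpart_cintegral set_itv1 Rintegral_set1 addr0.
have e0 w : e b 0 T w = cpart b (cexp (pairing u (val (Y T w)))).
  by rewrite /e /ob /cl (clamp_id T 0 T00) (clamp_id T T TT) psi0.
have eT w : e b T 0 w = cpart b (cexp (pairing (psi T) (val (Y 0 w)))).
  by rewrite /e /ob /cl (clamp_id T 0 T00) (clamp_id T T TT).
have -> : \int[P]_w e b 0 T w
    = \int[P]_w cpart b (cexp (pairing u (val (X T w)))).
  apply: ae_eq_Rintegral.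
  - exact: (mob Y tY b 0 T).
  - have := mob X tX b 0 T; rewrite /ob /cl (clamp_id T 0 T00) (clamp_id T T TT).
    by rewrite psi0.
  - by apply: filterS (XY T TT) => w wE; rewrite e0 wE.
move=> ->.
transitivity (\int[P]_w (fun=> cpart b (cexp (pairing (psi T) (val x0)))) w).
  apply: ae_eq_Rintegral.
  - exact: (mob Y tY b T 0).
  - exact: measurable_cst.
  - apply: filterS2 X0 (XY 0 T00) => w X0w Y0w.
    by rewrite eT Y0w X0w.
rewrite Rintegral_cst; last exact: measurableT.
have P1 : fine (P [set: Omega]) = 1 by exact: (congr1 fine (@probability_setT _ _ _ P)).
by rewrite [X in _ * X]P1 mulr1.
Qed.
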